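(* Let $s>1$, $C>1$ and $t\in(0,1)$. There exist $\varepsilon=\varepsilon(s,C,t)>0$ and $N_0=N_0(s,C,t)\in\mathbb{N}$ such that the following holds: if $N\ge N_0$ and $A\subset[0,1]^2$ is a subset of a set which is discrete $(s,C)$-Ahlfors regular at scale $2^{-N}$, then $$\left|\{x\in A:\ \mathcal{N}(\mathrm{dist}(x,A),2^{-N})<2^{tN}\}\right|\le 2^{(s-\varepsilon)N}.$$
   Context: A set $A\subset\mathbb{R}^d$ is discrete $(s,C)$-Ahlfors regular at scale $2^{-N}$ if $C^{-1}2^{(N-k)s}\le |B(x,2^{-k})\cap A|\le C\,2^{(N-k)s}$ for all $x\in A$ and all $k\in\{0,1,\ldots,N-1\}$. Here $|\cdot|$ denotes cardinality of a set, and $B(x,r)$ is the ball of center $x$ and radius $r$ (here in $\mathbb{R}^2$). For $x\in\mathbb{R}^2$ and $A\subset\mathbb{R}^2$, the pinned distance set is $\mathrm{dist}(x,A)=\{|x-y|:y\in A\}\subset\mathbb{R}$. For a bounded set $F\subset\mathbb{R}^d$, $\mathcal{N}(F,\delta)$ is the number of $\delta$-grid cubes (cubes of side $\delta$ of the form $\prod_i[j_i\delta,(j_i+1)\delta)$, $j_i\in\mathbb{Z}$) that intersect $F$. *)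

(* Defs.v *)
From HB Require Import structures.
From mathcomp Require Import all_boot all_order all_algebra.
From mathcomp Require Import all_classical all_reals all_analysis.

Set Implicit Arguments.
Unset Strict Implicit.
Unset Printing Implicit Defensive.

Import Order.TTheory GRing.Theory Num.Theory.

Local Open Scope classical_set_scope.
Local Open Scope ring_scope.

(* The library's norm on row vectors is the sup norm, so the Euclidean
   distance and its balls are defined here. *)
Definition edist (R : realType) (d : nat) (x y : 'rV[R]_d) : R :=
  Num.sqrt (\sum_(i < d) (x 0 i - y 0 i) ^+ 2).

(* Closed balls. Using open balls instead only changes the constant C in
   [discrete_ahlfors_regular] below (for N >= 2). *)
Definition eball (R : realType) (d : nat) (x : 'rV[R]_d) (r : R) :
    set 'rV[R]_d :=
  [set y | edist x y <= r].

(* Cardinalities are taken in \bar R with [counting], which is +oo on infinite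
   sets; in particular the upper bound forces the set to be locally finite. *)
Definition discrete_ahlfors_regular (R : realType) (d : nat) (s C : R)
    (N : nat) (A : set 'rV[R]_d) : Prop :=
  forall x, A x -> forall k : nat, (k < N)%N ->
    ((C^-1 * 2 `^ ((N - k)%:R * s))%:E <= counting (eball x (2 ^- k) `&` A))%E
    /\ (counting (eball x (2 ^- k) `&` A) <= (C * 2 `^ ((N - k)%:R * s))%:E)%E.

Definition pinned_dist (R : realType) (d : nat) (x : 'rV[R]_d)
    (A : set 'rV[R]_d) : set R :=
  [set edist x y | y in A].

(* Grid cubes in dimension one: the intervals [j delta, (j + 1) delta). *)
Definition grid_intervals (R : realType) (delta : R) : set (set R) :=
  [set Q | exists j : int, Q = [set` `[j%:~R * delta, (j + 1)%:~R * delta[ ]].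

Definition grid_number (R : realType) (F : set R) (delta : R) : \bar R :=
  counting [set Q | grid_intervals delta Q /\ Q `&` F !=set0].

Definition unit_cube (R : realType) (d : nat) : set 'rV[R]_d :=
  [set x | forall i, 0 <= x 0 i <= 1].

(* Main.v *)
Require Import Defs.
From HB Require Import structures.
From mathcomp Require Import finmap.
From mathcomp Require Import all_boot all_order all_algebra.
From mathcomp Require Import all_classical all_reals all_analysis.
From mathcomp Require Import zify ring lra.

(* Suppose that many points of A see few distances. Zooming into the dyadic
   square which maximises (number of points) * (side)^(-s'), with 1 < s' < s,
   makes the uniform measure on A satisfy a Frostman condition of exponent s'
   at all scales, at the cost of a small fraction of the scales.

   Split the scales into blocks of length q. For fixed x, the chain rule for
   entropy along the blocks bounds log |A| by the logarithm of the number of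
   distances from x plus, for every block, the mean over y of log n(x, y), where
   n(x, y) is the number of next-scale squares in the local strip through y
   orthogonal to x - y. As log |A| is nearly s N log 2, it suffices that
   n(x, y) <= 2^((s - t') q) for some t' > t and most pairs (x, y).

   By regularity, double counting over the 2^q directions leaves, for each y,
   O(q 2^(t' q)) bad ones. These contribute little unless the corresponding
   cones with vertex y carry mass at least 2^(-(1 - al) q). The pairs lying in
   such heavy cones are controlled by the mean over directions of the L^2 norm
   of the projections of A at scale 2^(-q): it is nondecreasing in q because
   dyadic conditional expectations form a martingale, it is bounded because
   s' > 1, and its increment between two scales dominates the mass of the
   heavy pairs at the finer one. Hence q can be pigeonholed among finitely many
   values so that the heavy pairs are negligible. *)

Set Implicit Arguments.
Unset Strict Implicit.
Unset Printing Implicit Defensive.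

Import Order.TTheory GRing.Theory Num.Theory.

Local Open Scope ring_scope.

(** * Counting the values of a function *)

(** Counted on a duplicate-free list, since the values usually lie in the infinite types [int] and
    [int * int]. *)
Definition nimg (T : finType) (U : eqType) (S : {set T}) (g : T -> U) : nat :=
  size (undup [seq g z | z <- enum S]).

Lemma mem_img (T : finType) (U : eqType) (S : {set T}) (g : T -> U) c :
  reflect (exists2 z, z \in S & g z = c) (c \in undup [seq g z | z <- enum S]).
Proof.
rewrite mem_undup; apply: (iffP mapP) => -[z zS e]; exists z => //.
  by move: zS; rewrite mem_enum.
by rewrite mem_enum.
Qed.

Lemma nimg_le_size (T : finType) (U : eqType) (S : {set T}) (g : T -> U) (u : seq U) :
  {in S, forall z, g z \in u} -> (nimg S g <= size u)%N.
Proof.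
move=> H; apply: uniq_leq_size; first exact: undup_uniq.
by move=> c /mem_img[z zS <-]; apply: H.
Qed.

Lemma nimgS (T : finType) (U : eqType) (S S' : {set T}) (g : T -> U) :
  S \subset S' -> (nimg S g <= nimg S' g)%N.
Proof.
move=> /fintype.subsetP sub; apply: nimg_le_size => z zS.
by apply/mem_img; exists z => //; apply: sub.
Qed.

(** Choosing a preimage in [S] for every value of [g] yields a list, no longer than that of the
    [g]-values, which exhausts the values of [h]. *)
Lemma nimg_factor (T : finType) (U V : eqType) (S : {set T}) (g : T -> U) (h : T -> V) :
  {in S &, forall z w, g z = g w -> h z = h w} -> (nimg S h <= nimg S g)%N.
Proof.
move=> H; case: (set_0Vmem S) => [->|[z0 z0S]].
  by rewrite /nimg enum_set0.
set u := undup [seq g z | z <- enum S].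
pose r c := odflt z0 [pick z | (z \in S) && (g z == c)].
rewrite /(nimg S g) -/u -(size_map (h \o r)).
apply: nimg_le_size => z zS; apply/mapP; exists (g z).
  by apply/mem_img; exists z.
rewrite /r /=; case: pickP => [w /andP[wS /eqP e]|/(_ z)] /=.
  by apply: H.
by rewrite zS eqxx.
Qed.

Lemma nimg_gt0 (T : finType) (U : eqType) (S : {set T}) (g : T -> U) z :
  z \in S -> (0 < nimg S g)%N.
Proof.
move=> zS; have : g z \in undup [seq g z | z <- enum S] by apply/mem_img; exists z.
by rewrite /nimg; case: (undup _).
Qed.

Lemma sum_partition_img (R : numDomainType) (T : finType) (U : eqType) (S : {set T})
    (g : T -> U) (F : T -> R) :
  \sum_(z in S) F z =
  \sum_(c <- undup [seq g z | z <- enum S]) \sum_(z in S | g z == c) F z.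
Proof.
rewrite (exchange_big_dep (fun z => z \in S)) //=; last by move=> c z _ /andP[].
apply: eq_bigr => z zS.
rewrite -big_filter (_ : seq.filter _ _ = [:: g z]) ?big_seq1 //.
have : [seq i <- undup [seq g w | w <- enum S] | (z \in S) && (g z == i)] =
  [seq i <- undup [seq g w | w <- enum S] | pred1 (g z) i].
  by apply: eq_filter => i; rewrite zS /= eq_sym.
move->; rewrite filter_pred1_uniq ?undup_uniq //.
by apply/mem_img; exists z.
Qed.

Lemma card_class_gt0 (T : finType) (U : eqType) (g : T -> U) z :
  (0 < #|[set w | g w == g z]|)%N.
Proof. by apply/card_gt0P; exists z; rewrite inE. Qed.

(** The terms of one class add up to at most 1, with equality when [S] contains the whole class. *)
Lemma sum_inv_class (R : realFieldType) (T : finType) (U : eqType) (S : {set T})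
    (g : T -> U) :
  \sum_(z in S) (#|[set w | g w == g z]|%:R)^-1 <= (nimg S g)%:R :> R.
Proof.
rewrite (sum_partition_img S g) /nimg.
set u := undup _.
have -> : (size u)%:R = \sum_(c <- u) (1 : R).
  by rewrite big_const_seq iter_addr addr0 count_predT.
apply: ler_sum => c _.
case: (pickP (fun z => (z \in S) && (g z == c))) => [z0 /andP[_ /eqP e0]|none]; last first.
  by rewrite big_pred0.
rewrite (eq_bigr (fun=> (#|[set w | g w == c]|%:R)^-1)); last first.
  by move=> z /andP[_ /eqP ->].
rewrite sumr_const -[X in X <= _]mulr_natl ler_pdivrMr; last first.
  by rewrite -e0 ltr0n card_class_gt0.
rewrite mul1r ler_nat subset_leq_card //.
by apply/fintype.subsetP => z; rewrite !inE => /andP[].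
Qed.

Lemma nimg_le_mul (T : finType) (U V : eqType) (S : {set T}) (g : T -> U) (h : T -> V) m :
  (forall y, y \in S -> (nimg [set z in S | g z == g y] h <= m)%N) ->
  (nimg S h <= nimg S g * m)%N.
Proof.
move=> H; set u := undup [seq g z | z <- enum S].
pose l := [seq undup [seq h z | z <- enum [set z in S | g z == c]] | c <- u].
apply: (@leq_trans (size (flatten l))).
  apply: nimg_le_size => z zS; apply/flattenP.
  exists (undup [seq h w | w <- enum [set w in S | g w == g z]]).
    by apply/mapP; exists (g z) => //; apply/mem_img; exists z.
  by apply/mem_img; exists z => //; rewrite !inE zS eqxx.
rewrite size_flatten /shape -map_comp sumnE big_map /nimg -/u -sum1_size big_distrl /=.
rewrite big_seq [leqRHS]big_seq; apply: leq_sum => c /mem_img[z zS <-].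
by rewrite mul1n; apply: H.
Qed.

Lemma nimg_int (T : finType) (S : {set T}) (g : T -> int) (b : int) (r : nat) :
  {in S, forall z, b <= g z < b + r%:Z} -> (nimg S g <= r)%N.
Proof.
move=> H; rewrite -(size_iota 0 r) -(size_map (fun i : nat => b + i%:Z)).
apply: nimg_le_size => z /H /andP[h1 h2]; apply/mapP.
exists `|(g z - b)%R|%N; first by rewrite mem_iota; lia.
lia.
Qed.

Lemma nimg_pair (T : finType) (U V : eqType) (S : {set T}) (g : T -> U) (h : T -> V) :
  (nimg S (fun z => (g z, h z)) <= nimg S g * nimg S h)%N.
Proof.
rewrite /nimg -(size_allpairs pair).
apply: nimg_le_size => z zS; apply/allpairsP; exists (g z, h z); split => //=.
  by apply/mem_img; exists z.
by apply/mem_img; exists z.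
Qed.

Lemma card_le_nimg (R : numDomainType) (T : finType) (U : eqType) (S : {set T}) (g : T -> U) (m
  : R) :
  (forall y, y \in S -> #|[set z in S | g z == g y]|%:R <= m) ->
  #|S|%:R <= (nimg S g)%:R * m.
Proof.
move=> H; rewrite -sum1_card natr_sum (sum_partition_img S g) /nimg.
set u := undup _.
have -> : (size u)%:R * m = \sum_(c <- u) m.
  by rewrite big_const_seq iter_addr addr0 count_predT mulr_natl.
rewrite big_seq [leRHS]big_seq; apply: ler_sum => _ /mem_img[y yS <-].
apply: le_trans (H y yS); rewrite sumr_const ler_nat subset_leq_card //.
by apply/fintype.subsetP => z; rewrite !inE.
Qed.

Lemma nimg_transport (T T' : finType) (U U' : eqType) (S : {set T}) (S' : {set T'})
    (f : T -> T') (g : T -> U) (g' : T' -> U') :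
  {in S, forall z, f z \in S'} ->
  {in S &, forall z w, g' (f z) = g' (f w) -> g z = g w} ->
  (nimg S g <= nimg S' g')%N.
Proof.
move=> fS H; apply: (@leq_trans (nimg S (g' \o f))); first exact: nimg_factor.
by apply: nimg_le_size => z zS; apply/mem_img; exists (f z) => //; apply: fS.
Qed.

(** * An entropy inequality *)

Lemma ln_le_tangent (R : realType) (w c : R) : 0 < w -> 0 < c -> ln w <= w / c - 1 + ln c.
Proof.
move=> w0 c0; have wc : 0 < w / c by rewrite divr_gt0.
have := @le_ln1Dx R (w / c - 1).
rewrite [1 + _]addrC subrK ln_div ?posrE //; lra.
Qed.

(** This is Jensen's inequality with a reference weight [c] depending on [y]: the tangent of the
    logarithm is taken at [c y], and by hypothesis the linear terms add up to at most 0. *)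
Lemma sum_ln_le (R : realType) (T : finType) (W c : T -> R) :
  (forall y, 0 < W y) -> (forall y, 0 < c y) ->
  \sum_y W y / c y <= #|T|%:R -> \sum_y ln (W y) <= \sum_y ln (c y).
Proof.
move=> W0 c0 H.
apply: (@le_trans _ _ (\sum_y ((W y / c y - 1) + ln (c y)))).
  by apply: ler_sum => y _; apply: ln_le_tangent.
rewrite big_split /= gerDr sumrB sumr_const subr_le0.
exact: H.
Qed.

Lemma natr_card (R : numDomainType) (T : finType) (P : pred T) :
  #|[set w | P w]|%:R = \sum_(w | P w) 1 :> R.
Proof. by rewrite sumr_const cardsE. Qed.

Section Entropy.
Variables (R : realType) (T : finType) (U V : eqType).

Lemma double_count_sym (r : rel T) (F : T -> R) :
  (forall x y, r x y = r y x) ->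
  \sum_y #|[set w | r y w]|%:R * F y = \sum_w \sum_(y | r w y) F y.
Proof.
move=> sym; rewrite [RHS](exchange_big_dep xpredT) //=; apply: eq_bigr => y _.
rewrite natr_card big_distrl /=; apply: eq_big => w; first exact: sym.
by rewrite mul1r.
Qed.

(* Inside one Q-class, the conditional masses of the values of I' given I sum
   to at most the number of values of I. *)
Lemma sum_conditional_le (Q : T -> U) (I I' : T -> V) (c : nat) :
  (forall z w, I' z = I' w -> I z = I w) ->
  (forall y, (nimg [set z | Q z == Q y] I <= c)%N) ->
  \sum_y (#|[set z | Q z == Q y]|%:R * #|[set z | I' z == I' y]|%:R /
     (#|[set z | I z == I y]|%:R * #|[set z | (Q z == Q y) && (I' z == I' y)]|%:R))
   <= c%:R * #|T|%:R :> R.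
Proof.
move=> ref Hc.
pose F y : R := #|[set z | I' z == I' y]|%:R /
     (#|[set z | I z == I y]|%:R * #|[set z | (Q z == Q y) && (I' z == I' y)]|%:R).
rewrite (eq_bigr (fun y => #|[set w | Q w == Q y]|%:R * F y)); last first.
  by move=> y _; rewrite /F mulrA.
rewrite (double_count_sym (r := fun y w => Q w == Q y)); last first.
  by move=> x y; rewrite eq_sym.
rewrite mulr_natr -sumr_const.
apply: ler_sum => w _.
pose S := [set v : T | [exists y, (Q y == Q w) && (I' y == I' v)]].
apply: (@le_trans _ _ (\sum_(v in S) (#|[set z | I z == I v]|%:R)^-1)); last first.
  apply: (le_trans (sum_inv_class R _ _)); rewrite ler_nat.
  apply: leq_trans (Hc w); apply: nimg_le_size => v.
  rewrite inE => /existsP[y /andP[Qy /eqP Iy]]; apply/mem_img; exists y.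
    by rewrite inE.
  exact: ref.
rewrite /F; under eq_bigr => y _ do rewrite natr_card big_distrl /=.
rewrite (exchange_big_dep (fun v => v \in S)) /=; last first.
  move=> y v Qy Iv; rewrite inE; apply/existsP; exists y.
  by rewrite Qy eq_sym Iv.
apply: ler_sum => v; rewrite inE => /existsP[y0 /andP[/eqP Qy0 /eqP Iy0]].
rewrite (eq_bigr (fun=> (#|[set z | I z == I v]|%:R * #|[set z | (Q z == Q w) && (I' z == I'
  v)]|%:R)^-1)); last first.
  move=> y /andP[/eqP Qy /eqP Iv].
  by rewrite mul1r -Iv -Qy (ref v y).
rewrite sumr_const -[X in X <= _]mulr_natl invfM mulrCA.
have -> : #|(fun i => (Q i == Q w) && (I' v == I' i))| = #|[set z | (Q z == Q w) && (I' z == I'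
  v)]|.
  by apply: eq_card => z; rewrite !inE [I' z == _]eq_sym.
rewrite divff ?mulr1 // pnatr_eq0 -lt0n; apply/card_gt0P; exists y0.
by rewrite inE Qy0 Iy0 !eqxx.
Qed.

(** Inside a joint class of [Q] and [I'], the inverse sizes of the [Q']-classes add up to at most
    the number of [Q']-values there. After double counting and division by that number, each point
    accounts for at most 1. *)
Lemma sum_split_le (Q Q' : T -> U) (I' : T -> V) :
  \sum_y (#|[set z | (Q z == Q y) && (I' z == I' y)]|%:R / #|[set z | Q' z == Q' y]|%:R
     / (nimg [set z | (Q z == Q y) && (I' z == I' y)] Q')%:R)
   <= #|T|%:R :> R.
Proof.
pose n y := nimg [set z | (Q z == Q y) && (I' z == I' y)] Q'.
pose F y : R := (#|[set z | Q' z == Q' y]|%:R)^-1 / (n y)%:R.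
rewrite (eq_bigr (fun y => #|[set w | (Q w == Q y) && (I' w == I' y)]|%:R * F y)); last first.
  by move=> y _; rewrite /F mulrA.
rewrite (double_count_sym (r := fun y w => (Q w == Q y) && (I' w == I' y))); last first.
  by move=> x y; rewrite eq_sym [I' y == _]eq_sym.
rewrite -[leRHS]mulr1 mulr_natl -sumr_const.
apply: ler_sum => w _.
have nw : (0 < n w)%N by apply: (@nimg_gt0 _ _ _ _ w); rewrite inE !eqxx.
rewrite (eq_bigr (fun y => (#|[set z | Q' z == Q' y]|%:R)^-1 / (n w)%:R)); last first.
  by move=> y /andP[/eqP Qy /eqP Iy]; rewrite /F /n Qy Iy.
rewrite -mulr_suml ler_pdivrMr ?ltr0n // mul1r /n.
apply: le_trans (sum_inv_class R _ _); rewrite le_eqVlt; apply/orP; left; apply/eqP.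
by apply: eq_bigl => z; rewrite inE.
Qed.

(** Divided by |T|, this reads H(Q') - H(Q) <= ln c + E ln n + H(I') - H(I) for the uniform measure,
    [n] being the number of [Q']-values in a joint class. It combines H(I' | Q) <= H(I' | I) + H(I |
    Q) with H(Q' | Q, I') <= E ln n. *)
Lemma entropy_step (Q Q' : T -> U) (I I' : T -> V) (c : nat) :
  (forall z w, I' z = I' w -> I z = I w) ->
  (forall y, (nimg [set z | Q z == Q y] I <= c)%N) ->
  \sum_y (ln (#|[set z | Q z == Q y]|%:R) - ln (#|[set z | Q' z == Q' y]|%:R)) <=
  #|T|%:R * ln (c%:R) +
  \sum_y ln ((nimg [set z | (Q z == Q y) && (I' z == I' y)] Q')%:R) +
  \sum_y (ln (#|[set z | I z == I y]|%:R) - ln (#|[set z | I' z == I' y]|%:R)) :> R.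
Proof.
move=> ref Hc.
have pos (P : pred T) y : P y -> 0 < #|[set z | P z]|%:R :> R.
  by move=> Py; rewrite ltr0n; apply/card_gt0P; exists y; rewrite inE.
(* The telescoping factorisation a / a' = (a b' / (b d)) (d / a') (b / b'). *)
pose a y : R := #|[set z | Q z == Q y]|%:R.
pose a' y : R := #|[set z | Q' z == Q' y]|%:R.
pose b y : R := #|[set z | I z == I y]|%:R.
pose b' y : R := #|[set z | I' z == I' y]|%:R.
pose d y : R := #|[set z | (Q z == Q y) && (I' z == I' y)]|%:R.
pose n y : R := (nimg [set z | (Q z == Q y) && (I' z == I' y)] Q')%:R.
have a0 y : 0 < a y by apply: (pos _ y).
have a'0 y : 0 < a' y by apply: (pos _ y).
have b0 y : 0 < b y by apply: (pos _ y).
have b'0 y : 0 < b' y by apply: (pos _ y).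
have d0 y : 0 < d y by apply: (pos _ y); rewrite !eqxx.
have n0 y : 0 < n y by rewrite ltr0n; apply: (@nimg_gt0 _ _ _ _ y); rewrite inE !eqxx.
case: (pickP (@predT T)) => [y0 _|none]; last first.
  by rewrite !big_pred0 // eq_card0 // mul0r !addr0.
have c0 : 0 < c%:R :> R.
  rewrite ltr0n; apply: leq_trans (Hc y0); apply: (@nimg_gt0 _ _ _ _ y0).
  by rewrite inE.
have h1 : \sum_y ln (a y * b' y / (b y * d y)) <= \sum_(y : T) ln (c%:R : R).
  apply: sum_ln_le => [y|//|]; first by rewrite divr_gt0 ?mulr_gt0.
  rewrite -mulr_suml ler_pdivrMr // mulrC.
  exact: sum_conditional_le.
have h2 : \sum_y ln (d y / a' y) <= \sum_y ln (n y).
  apply: sum_ln_le => [y|//|]; first by rewrite divr_gt0.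
  exact: sum_split_le.
rewrite sumr_const -[X in _ <= X]mulr_natl in h1.
rewrite [X in X <= _](_ : _ = \sum_y ln (a y * b' y / (b y * d y)) +
   \sum_y ln (d y / a' y) + \sum_y (ln (b y) - ln (b' y))).
  by rewrite lerD2r; apply: lerD; [exact: h1|exact: h2].
rewrite -!big_split /=; apply: eq_bigr => y _.
rewrite ln_div ?posrE ?mulr_gt0 // ln_div ?posrE // !lnM ?posrE //.
rewrite -/(a y) -/(a' y); ring.
Qed.

(** Divided by |T|, the left side is the entropy of [I]; the bound follows from the concavity of the
    logarithm. *)
Lemma sum_ln_class_le (I : T -> V) :
  \sum_y (ln (#|T|%:R) - ln (#|[set z | I z == I y]|%:R)) <=
  #|T|%:R * ln (nimg [set: T] I)%:R :> R.
Proof.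
case: (pickP (@predT T)) => [y0 _|none]; last first.
  by rewrite !big_pred0 // eq_card0 // mul0r.
have T0 : 0 < #|T|%:R :> R by rewrite ltr0n; apply/card_gt0P; exists y0.
have b0 y : 0 < #|[set z | I z == I y]|%:R :> R.
  by rewrite ltr0n; apply: card_class_gt0.
have n0 : 0 < (nimg [set: T] I)%:R :> R by rewrite ltr0n (@nimg_gt0 _ _ _ _ y0) // inE.
rewrite [leRHS](_ : _ = \sum_(y : T) ln (nimg [set: T] I)%:R); last first.
  by rewrite sumr_const -[RHS]mulr_natl.
rewrite (eq_bigr (fun y => ln (#|T|%:R / #|[set z | I z == I y]|%:R))); last first.
  by move=> y _; rewrite ln_div ?posrE.
apply: sum_ln_le => [y|//|]; first by rewrite divr_gt0.
rewrite -mulr_suml -mulr_sumr -mulrA ler_piMr // ?(ltW T0) //.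
rewrite ler_pdivrMr // mul1r; apply: le_trans (sum_inv_class R _ _).
by rewrite le_eqVlt; apply/orP; left; apply/eqP/eq_bigl => z; rewrite inE.
Qed.

(** The steps telescope. Bounding the classes of [I 0] by the whole of [T] turns the remaining
    increment of [I] into the full entropy of [I M]. In the application [Q j] is the dyadic square
    of a point and [I j] the dyadic interval of its distance to a fixed [x]. *)
Lemma entropy_chain (Q : nat -> T -> U) (I : nat -> T -> V) (M c : nat) :
  (forall j z w, I j.+1 z = I j.+1 w -> I j z = I j w) ->
  (forall j y, (nimg [set z | Q j z == Q j y] (I j) <= c)%N) ->
  \sum_y (ln (#|[set z | Q 0 z == Q 0 y]|%:R) - ln (#|[set z | Q M z == Q M y]|%:R)) <=
  #|T|%:R * ln (nimg [set: T] (I M))%:R +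
  \sum_(j < M) (#|T|%:R * ln (c%:R) +
    \sum_y ln ((nimg [set z | (Q j z == Q j y) && (I j.+1 z == I j.+1 y)] (Q j.+1))%:R)) :> R.
Proof.
move=> ref Hc.
pose A j : R := \sum_y ln (#|[set z | Q j z == Q j y]|%:R).
pose B j : R := \sum_y ln (#|[set z | I j z == I j y]|%:R).
pose E j : R := #|T|%:R * ln (c%:R) +
    \sum_y ln ((nimg [set z | (Q j z == Q j y) && (I j.+1 z == I j.+1 y)] (Q j.+1))%:R).
have step j : A j - A j.+1 <= E j + (B j - B j.+1).
  rewrite /A /B -!sumrB; apply: entropy_step => //; exact: ref.
have tel : A 0 - A M <= \sum_(j < M) E j + (B 0 - B M).
  elim: M => [|m IH]; first by rewrite big_ord0 !subrr addr0.
  rewrite big_ord_recr /=; have := step m; lra.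
rewrite sumrB -/(A 0) -/(A M); apply: (le_trans tel).
rewrite addrC lerD2r; apply: le_trans (sum_ln_class_le _).
rewrite sumrB lerD2r; apply: ler_sum => y _.
rewrite ler_ln ?posrE ?ltr0n ?card_class_gt0 ?ler_nat ?max_card //.
by apply/card_gt0P; exists y.
Qed.

End Entropy.

(** * Slopes of strips *)

(** The least and the greatest admissible index differ by at most 2 w / c. *)
Lemma card_progression (R : realFieldType) (n : nat) (c e w : R) :
  0 < c -> 0 <= w ->
  #|[set k : 'I_n | `|k%:R * c - e| <= w]|%:R * c <= 2 * w + c.
Proof.
move=> c0 w0; set S := [set k : 'I_n | _].
case: (set_0Vmem S) => [->|[i iS]]; first by rewrite cards0 mul0r; lra.
case: (arg_minnP (fun k : 'I_n => k : nat) iS) => k0 k0S k0m.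
case: (arg_maxnP (fun k : 'I_n => k : nat) iS) => k1 k1S k1M.
have le01 : (k0 <= k1)%N := k0m _ k1S.
have cS : (#|S| <= k1 - k0 + 1)%N.
  rewrite cardE -(size_map val) -[leqRHS](size_iota k0).
  apply: uniq_leq_size; first by rewrite (map_inj_uniq val_inj) enum_uniq.
  move=> x /mapP[k]; rewrite mem_enum => kS ->; rewrite mem_iota.
  by have := k0m k kS; have := k1M k kS; rewrite /=; lia.
apply: (@le_trans _ _ ((k1 - k0 + 1)%:R * c)).
  by rewrite ler_pM2r // ler_nat.
rewrite natrD natrB // mulrDl mul1r lerD2r mulrBl.
have {}k0S : k0 \in S := k0S; have {}k1S : k1 \in S := k1S.
move: k0S k1S; rewrite !inE !ler_norml => /andP[h1 h2] /andP[h3 h4]; lra.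
Qed.

(* Indices k < 3 * 2 ^ Q run through a grid of mesh 2 ^- Q in [-1, 2). *)
Definition slope_of (R : realFieldType) (Q k : nat) : R := k%:R / 2 ^+ Q - 1.

Lemma slope_of_bound (R : realFieldType) (Q k : nat) :
  (k < 3 * 2 ^ Q)%N -> `|slope_of R Q k| <= 2.
Proof.
move=> kl; have p0 : 0 < 2 ^+ Q :> R by rewrite exprn_gt0.
have k0 : 0 <= k%:R / 2 ^+ Q :> R by rewrite divr_ge0 // ltW.
have k3 : k%:R / 2 ^+ Q <= 3 :> R.
  by rewrite ler_pdivrMr // -natrX -natrM ler_nat ltnW.
by rewrite /slope_of ler_norml; apply/andP; split; lra.
Qed.

(** Transversality: a point at sup distance d from the centre lies in the strip of width about w for
    a proportion of order w / d of the slopes. *)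
Lemma card_strip_slopes (R : realFieldType) (Q : nat) (h v w : R) :
  Num.max `|h| `|v| <= 2 ^+ Q * w ->
  #|[set k : 'I_(3 * 2 ^ Q) | `|h + slope_of R Q k * v| <= w]|%:R * Num.max `|h| `|v|
    <= 12 * 2 ^+ Q * w.
Proof.
set d := Num.max _ _ => dw; set S := [set k | _].
have p0 : 0 < 2 ^+ Q :> R by rewrite exprn_gt0.
have d0 : 0 <= d by rewrite le_max normr_ge0.
have hd : `|h| <= d by rewrite le_max lexx.
have vd : `|v| <= d by rewrite le_max lexx orbT.
have w0 : 0 <= w by rewrite -(pmulr_rge0 _ p0) (le_trans d0).
have cS : #|S|%:R <= 3 * 2 ^+ Q :> R.
  by rewrite -natrX -natrM ler_nat (leq_trans (max_card _)) ?card_ord.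
(* If [v] is comparable to [d], the slopes fill an interval of length 2 w / |v|. Otherwise [h]
   dominates; as slopes are at most 2 in size, an admissible slope forces [d <= 2 * w], and counting
   all slopes is enough. *)
have [vbig|vsmall] := lerP d (4 * `|v|); last first.
  case: (set_0Vmem S) => [->|[k]]; first by rewrite cards0 mul0r !mulr_ge0 // ltW.
  rewrite inE => kS; have a2 := slope_of_bound R (ltn_ord k).
  have hh : d = `|h|.
    have : d \in [:: `|h|; `|v|] by rewrite /d maxEle; case: ifP; rewrite !inE eqxx ?orbT.
    by rewrite !inE => /orP[] /eqP // e; move: vsmall; rewrite e; have := normr_ge0 v; lra.
  have av : `|slope_of R Q k * v| <= 2 * `|v| by rewrite normrM ler_wpM2r.
  have : `|h| <= `|h + slope_of R Q k * v| + `|slope_of R Q k * v|.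
    by rewrite -{1}(addrK (slope_of R Q k * v) h) ler_normB.
  rewrite -hh => tri; have dw2 : d <= 2 * w by lra.
  apply: (@le_trans _ _ (3 * 2 ^+ Q * (2 * w))); first by apply: ler_pM.
  by have := mulr_ge0 (ltW p0) w0; lra.
have [v0|v0] := eqVneq v 0.
  have -> : d = 0 by move: vbig; rewrite v0 normr0; lra.
  by rewrite mulr0 !mulr_ge0 // ltW.
have nv : 0 < `|v| by rewrite normr_gt0.
have : #|S|%:R * (`|v| / 2 ^+ Q) <= 2 * w + `|v| / 2 ^+ Q.
  have c0 : 0 < `|v| / 2 ^+ Q by rewrite divr_gt0.
  have -> : S = [set k : 'I_(3 * 2 ^ Q) | `|k%:R * (`|v| / 2 ^+ Q) - Num.sg v * (v - h)| <= w].
    apply/setP => k; rewrite !inE; congr (_ <= _).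
    have sg1 : `|Num.sg v| = 1 by rewrite normr_sg v0.
    rewrite -[LHS]mul1r -{1}sg1 -normrM; congr `|_|.
    rewrite /slope_of [ `|v|]normrEsg; ring.
  exact: card_progression.
have e1 : #|S|%:R * (`|v| / 2 ^+ Q) * 2 ^+ Q = #|S|%:R * `|v|.
  by rewrite -mulrA divfK // gt_eqF.
move=> /(ler_wpM2r (ltW p0)); rewrite e1 mulrDl divfK ?gt_eqF // => H.
have : #|S|%:R * d <= #|S|%:R * (4 * `|v|) by rewrite ler_wpM2l.
rewrite mulrCA => H2; apply: (le_trans H2).
rewrite -mulrA [2 ^+ Q * w]mulrC; rewrite -[2 * w * _]mulrA in H; rewrite mulrC in dw.
move: H vd dw; set A := w * 2 ^+ Q; set B := _ * `|v|; lra.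
Qed.

(** Let m be the last layer containing [d]. If m = q, the last hypothesis applies; otherwise [d]
    exceeds 2^-(l+m+1) and the product bound gives c <= 2 E 2^m. Writing the result as a sum over
    layers avoids dividing by [d], which may vanish, and allows summation over many points. *)
Lemma dyadic_layer (R : realFieldType) (l q : nat) (c d E : R) :
  0 <= c -> d <= 2 ^- l -> c * d <= E * 2 ^- l -> c <= 2 * E * 2 ^+ q -> 
  c <= 2 * E * \sum_(m < q.+1) 2 ^+ m * (d <= 2 ^- (l + m))%R%:R.
Proof.
move=> c0; have p n : 0 < 2 ^+ n :> R by rewrite exprn_gt0.
elim: q => [|q IH] dl cd cE.
  by rewrite big_ord1 addn0 dl mulr1.
have E0 : 0 <= E.
  by have := le_trans c0 cE; rewrite pmulr_lge0 // pmulr_rge0.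
rewrite big_ord_recr /=.
have [dq|dq] := lerP d (2 ^- (l + q.+1)).
  rewrite mulr1 mulrDr (le_trans cE) // lerDr mulr_ge0 ?mulr_ge0 //.
  by apply: sumr_ge0 => i _; rewrite mulr_ge0 // ltW.
rewrite mulr0 addr0; apply: IH => //.
have : c * 2 ^- (l + q.+1) <= E * 2 ^- l.
  by apply: le_trans cd; rewrite ler_wpM2l // ltW.
move=> H; have i0 : 0 < 2 ^- (l + q.+1) :> R by rewrite invr_gt0.
rewrite -(ler_pM2r i0) (le_trans H) // addnS exprS exprD le_eqVlt.
by apply/orP; left; apply/eqP; field; rewrite !gt_eqF.
Qed.

(** The slope count is spread over dyadic layers of distance, so that covering bounds and Frostman
    bounds can be inserted layer by layer. *)
Lemma card_strip_slopes_layer (R : realFieldType) (l q Q : nat) (h v W : R) :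
  1 <= W -> (q <= Q)%N -> Num.max `|h| `|v| <= 2 ^- l ->
  #|[set k : 'I_(3 * 2 ^ Q) | `|h + slope_of R Q k * v| <= W * 2 ^- (l + q)]|%:R
   <= 24 * W * 2 ^+ (Q - q) *
      \sum_(m < q.+1) 2 ^+ m * (Num.max `|h| `|v| <= 2 ^- (l + m))%R%:R.
Proof.
move=> W1 qQ dl; have p n : 0 < 2 ^+ n :> R by rewrite exprn_gt0.
have -> : 24 * W * 2 ^+ (Q - q) = 2 * (12 * W * 2 ^+ (Q - q)) by ring.
have e : 2 ^+ Q * (W * 2 ^- (l + q)) = W * 2 ^+ (Q - q) * 2 ^- l.
  rewrite -{1}(subnK qQ) !exprD; field; rewrite !gt_eqF //.
apply: dyadic_layer => //.
  rewrite [leRHS](_ : _ = 12 * 2 ^+ Q * (W * 2 ^- (l + q))); last by rewrite -[RHS]mulrA e !mulrA.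
  apply: card_strip_slopes; rewrite e; apply: (le_trans dl).
  rewrite ler_peMl ?invr_ge0 ?(ltW (p l)) //.
  rewrite (le_trans W1) // ler_peMr ?exprn_ege1 ?ler1n //; exact: le_trans W1.
rewrite -!mulrA -exprD subnK //; apply: (@le_trans _ _ (3 * 2 ^+ Q)).
  have -> : 3 * 2 ^+ Q = (3 * 2 ^ Q)%:R :> R by rewrite natrM natrX.
  by rewrite ler_nat (leq_trans (max_card _)) ?card_ord.
have := ler_wpM2r (ltW (p Q)) W1; have := ltW (p Q); lra.
Qed.

(** * Dyadic intervals and projections *)

Definition dyfloor (R : realType) (l : nat) (u : R) : int := Num.floor (2 ^+ l * u).

Section Floor.
Variable R : realType.
Implicit Types u v : R.

Lemma dyfloor_bounds l u : (dyfloor l u)%:~R <= 2 ^+ l * u < (dyfloor l u)%:~R + 1.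
Proof.
have := floor_le (2 ^+ l * u); have := floorD1_gt (2 ^+ l * u).
by rewrite rmorphD /= => h1 h2; apply/andP.
Qed.

Lemma dyfloor_eq_dist l u v : dyfloor l u = dyfloor l v -> `|u - v| < 2 ^- l.
Proof.
have p0 : 0 < 2 ^+ l :> R by rewrite exprn_gt0.
move=> e; have /andP[h1 h2] := dyfloor_bounds l u; have /andP[h3 h4] := dyfloor_bounds l v.
rewrite -(ltr_pM2l p0) mulfV ?gt_eqF // -{1}(gtr0_norm p0) -normrM ltr_norml mulrBr.
by rewrite e in h1 h2; apply/andP; split; lra.
Qed.

Lemma dist_dyfloor l (c : nat) u v : `|u - v| <= c%:R * 2 ^- l -> `|dyfloor l u - dyfloor l v|
  <= c%:Z.
Proof.
have p0 : 0 < 2 ^+ l :> R by rewrite exprn_gt0.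
rewrite ler_pdivlMr // -{1}(gtr0_norm p0) -normrM mulrC mulrBr ler_norml => /andP[h1 h2].
have /andP[h3 h4] := dyfloor_bounds l u; have /andP[h5 h6] := dyfloor_bounds l v.
have A : (dyfloor l u - dyfloor l v)%:~R < (c%:Z + 1)%:~R :> R.
  by rewrite rmorphB rmorphD /= -pmulrn; lra.
have B : (- (c%:Z + 1))%:~R < (dyfloor l u - dyfloor l v)%:~R :> R.
  by rewrite rmorphN rmorphB rmorphD /= -pmulrn; lra.
move: A B; rewrite !ltr_int; lia.
Qed.

Lemma dyfloor_itv l u (b : int) : b%:~R <= 2 ^+ l * u < b%:~R + 1 -> dyfloor l u = b.
Proof.
move=> /andP[h1 h2]; have /andP[h3 h4] := dyfloor_bounds l u.
have A : (dyfloor l u)%:~R < (b + 1)%:~R :> R by rewrite rmorphD /=; lra.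
have B : b%:~R < (dyfloor l u + 1)%:~R :> R by rewrite rmorphD /=; lra.
move: A B; rewrite !ltr_int; lia.
Qed.

Lemma dyfloor_child l p u : dyfloor l u * 2 ^+ p <= dyfloor (l + p) u < dyfloor l u * 2 ^+ p +
  (2 ^ p)%:Z.
Proof.
have p0 n : 0 < 2 ^+ n :> R by rewrite exprn_gt0.
have /andP[h1 h2] := dyfloor_bounds l u; have /andP[h3 h4] := dyfloor_bounds (l + p) u.
have e : 2 ^+ (l + p) * u = 2 ^+ l * u * 2 ^+ p :> R by rewrite exprD; ring.
have A : (dyfloor l u)%:~R * 2 ^+ p <= 2 ^+ (l + p) * u by rewrite e ler_pM2r.
have B : 2 ^+ (l + p) * u < ((dyfloor l u)%:~R + 1) * 2 ^+ p by rewrite e ltr_pM2r.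
have pe : (2 ^+ p)%:~R = 2 ^+ p :> R by rewrite rmorphXn.
have A' : (dyfloor l u * 2 ^+ p)%:~R < (dyfloor (l + p) u + 1)%:~R :> R.
  by rewrite rmorphM rmorphD /= pe; lra.
have B' : (dyfloor (l + p) u)%:~R < (dyfloor l u * 2 ^+ p + 2 ^+ p)%:~R :> R.
  by rewrite rmorphD rmorphM /= pe; move: B; rewrite mulrDl mul1r; lra.
move: A' B'; rewrite !ltr_int.
have -> : (2 ^ p)%N%:Z = 2 ^+ p by rewrite -natrX natz.
lia.
Qed.

Lemma dyfloor_refine l p u v : dyfloor (l + p) u = dyfloor (l + p) v -> dyfloor l u = dyfloor l v.
Proof.
have := dyfloor_child l p u; have := dyfloor_child l p v => /[swap]; move=> + + e; rewrite e.
have -> : (2 ^ p)%N%:Z = 2 ^+ p by rewrite -natrX natz.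
have : 0 < 2 ^+ p :> int by rewrite exprn_gt0.
move: (2 ^+ p) (dyfloor (l + p) v) (dyfloor l u) (dyfloor l v) => a b c d a0 /andP[h1 h2]
  /andP[h3 h4].
nia.
Qed.

End Floor.

Section Projection.
Variables (R : realType) (T : finType) (f : T -> R).

Let mass l z : R := #|[set w | dyfloor l (f w) == dyfloor l (f z)]|%:R.

Lemma mass_gt0 l z : 0 < mass l z.
Proof. by rewrite ltr0n card_class_gt0. Qed.

(* The masses normalised by length form a martingale; heavy cells carry a
   definite part of its quadratic increment. *)
Lemma heavy_le_increment (q' p : nat) (P : pred T) :
  (forall z, P z -> 4 * mass q' z <= 2 ^+ p * mass (q' + p) z) ->
  \sum_(z | P z) mass (q' + p) z <= 2 * \sum_z (mass (q' + p) z - mass q' z / 2 ^+ p).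
Proof.
move=> HP; set r : R := 2 ^+ p; have r0 : 0 < r by rewrite exprn_gt0.
pose m z := mass (q' + p) z; pose x z := mass q' z / r.
have m0 z : 0 < m z by apply: mass_gt0.
(* Grouped by parent cells: a parent has at most 2^p children, and the sum of 1 / [m] over its
   points counts its nonempty children. *)
have step1 : \sum_z x z ^+ 2 / m z <= \sum_z x z.
  rewrite (eq_bigr (fun z => #|[set w | dyfloor q' (f w) == dyfloor q' (f z)]|%:R * (mass q' z
    / r ^+ 2 / m z))); last first.
    move=> z _; rewrite /x /mass; field; rewrite !gt_eqF // ltr0n card_class_gt0 //.
  rewrite (double_count_sym (r := fun y w => dyfloor q' (f w) == dyfloor q' (f y))); last first.
    by move=> y w; rewrite eq_sym.
  apply: ler_sum => w _.
  rewrite (eq_bigr (fun y => mass q' w / r ^+ 2 * (m y)^-1)); last first.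
    by move=> y /eqP e; rewrite /mass e.
  rewrite -mulr_sumr /x expr2 invfM mulrA -mulrA ler_piMr ?divr_ge0 ?(ltW r0) ?(ltW (mass_gt0 _
    _)) //.
  rewrite mulrC ler_pdivrMr // mul1r.
  rewrite (eq_bigl (fun y => y \in [set y | dyfloor q' (f y) == dyfloor q' (f w)])); last first.
    by move=> y; rewrite inE.
  apply: (le_trans (sum_inv_class R _ (fun y => dyfloor (q' + p) (f y)))).
  rewrite /r -natrX ler_nat; apply: (@nimg_int _ _ _ (dyfloor q' (f w) * 2 ^+ p)) => y.
  by rewrite inE => /eqP <-; apply: dyfloor_child.
have step2 z : m z - x z = (x z - x z ^+ 2 / m z) + (m z - x z) ^+ 2 / m z.
  by move: (m z) (m0 z) (x z) => M M0 X; field; rewrite gt_eqF.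
have -> : \sum_z (mass (q' + p) z - mass q' z / r) =
   (\sum_z x z - \sum_z x z ^+ 2 / m z) + \sum_z (m z - x z) ^+ 2 / m z.
  by rewrite -sumrB -big_split; apply: eq_bigr => z _; rewrite /= -step2.
suff : \sum_(z | P z) mass (q' + p) z <= 2 * \sum_z (m z - x z) ^+ 2 / m z by lra.
rewrite mulr_sumr big_mkcond /=; apply: ler_sum => z _.
have sq0 : 0 <= 2 * ((m z - x z) ^+ 2 / m z).
  by rewrite mulr_ge0 // divr_ge0 ?sqr_ge0 // ltW.
case: ifPn => // /HP; rewrite -/(m z) => h.
(* From [x <= m / 4] the quadratic term is at least 9/16 of [m], hence at least half of it. *)
have x4 : 4 * x z <= m z by rewrite /x mulrA ler_pdivrMr // [m z * r]mulrC.
have x0 : 0 <= x z by rewrite divr_ge0 // ltW // mass_gt0.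
rewrite mulrA ler_pdivlMr // -/(m z); have := m0 z; nra.
Qed.

Let adj l y : R := #|[set w | `|dyfloor l (f w) - dyfloor l (f y)| <= 1]|%:R.

(** This passes from heavy triples of adjacent cells to heavy single cells. The heaviest cell of a
    triple carries a third of its mass, and each of the three offsets [e] costs a factor 2, whence
    18 = 3 * 3 * 2. *)
Lemma adj_le_mass (l : nat) (t : R) :
  \sum_(y | 3 * t <= adj l y) adj l y <= 18 * \sum_(z | t <= mass l z) mass l z.
Proof.
pose g z := dyfloor l (f z).
pose N (e : int) y : R := #|[set w | g w == g y + e]|%:R.
set S := \sum_(z | t <= mass l z) _.
have Ne (e : int) : \sum_(y | t <= N e y) N e y <= 2 * S.
  have NE y z : g z = g y + e -> mass l z = N e y.
    by move=> E; rewrite /mass /N -/(g z) E.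
  (* A pair of points in cells at offset [e] is charged to the point with the heavier cell: to [y]
     in [A], to [z] in [B]. A point receives at most the mass of its own cell. *)
  pose A := \sum_(y | t <= mass l y) \sum_(z | (g z == g y + e) && (mass l z <= mass l y)) (1 :
    R).
  pose B := \sum_(z | t <= mass l z) \sum_(y | (g z == g y + e) && (mass l y <= mass l z)) (1 :
    R).
  have AS : A <= S.
    apply: ler_sum => y _; case: (pickP (fun z => (g z == g y + e) && (mass l z <= mass l y)))
      => [z0|none]; last first.
      by rewrite big_pred0 // ltW // mass_gt0.
    move=> /andP[/eqP e0]; apply: le_trans.
    rewrite sumr_const ler_nat subset_leq_card //; apply/fintype.subsetP => z.
    by rewrite !inE => /andP[/eqP ez _]; rewrite -/(g z) -/(g z0) ez e0.
  have BS : B <= S.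
    apply: ler_sum => z _; case: (pickP (fun y => (g z == g y + e) && (mass l y <= mass l z)))
      => [y0|none]; last first.
      by rewrite big_pred0 // ltW // mass_gt0.
    move=> /andP[/eqP e0]; apply: le_trans.
    rewrite sumr_const ler_nat subset_leq_card //; apply/fintype.subsetP => y.
    rewrite !inE => /andP[/eqP ez _]; rewrite -/(g y) -/(g y0).
    by apply/eqP; apply: (addIr e); rewrite -ez e0.
  suff : \sum_(y | t <= N e y) N e y <= A + B by lra.
  rewrite (eq_bigr (fun y => \sum_(z | g z == g y + e) 1)); last first.
    by move=> y _; rewrite /N natr_card.
  rewrite /A /B [X in _ + X](exchange_big_dep xpredT) //= big_mkcond [X in X + _]big_mkcond
    -big_split /=.
  apply: ler_sum => y _.
  have D0 (Q : pred T) : 0 <= \sum_(z | Q z) 1 :> R by apply: sumr_ge0.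
  case: ifPn => [tN|_]; last by apply: addr_ge0 => //; case: ifP.
  have [my|my] := boolP (t <= mass l y); last first.
    rewrite add0r;
    rewrite [leRHS](bigID (fun z => g z == g y + e)) /=.
    apply: (@le_trans _ _ (\sum_(i | (t <= mass l i) && ((g i == g y + e) && (mass l y <= mass
      l i)) && (g i == g y + e)) 1)); last by rewrite lerDl.
    rewrite le_eqVlt; apply/orP; left; apply/eqP/eq_bigl => z.
    case: eqP => E; rewrite ?andbF // (NE _ _ E) tN /= andbT.
    by apply/esym; rewrite (le_trans _ tN) // ltW // ltNge.
  rewrite (bigID (fun z => mass l z <= mass l y)) /= lerD //.
  rewrite [leRHS](bigID (fun z => ~~ (mass l z <= mass l y))) /=.
  apply: (@le_trans _ _ (\sum_(i | (t <= mass l i) && ((g i == g y + e) && (mass l y <= mass l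
    i)) && (~~ (mass l i <= mass l y))) 1)); last by rewrite lerDl.
  rewrite le_eqVlt; apply/orP; left; apply/eqP/eq_bigl => z.
  case: eqP => E; rewrite ?andbF //= (NE _ _ E) tN /= -ltNge.
  by case: ltP => // h; rewrite ?andbT ?andbF // ltW.
have key y : (if 3 * t <= adj l y then adj l y else 0) <=
    3 * ((if t <= N (-1) y then N (-1) y else 0) + (if t <= N 0 y then N 0 y else 0) +
         (if t <= N 1 y then N 1 y else 0)).
  have N0 e : 0 <= N e y by rewrite ler0n.
  have : adj l y <= N (-1) y + N 0 y + N 1 y.
    rewrite /adj /N -!natrD ler_nat.
    apply: leq_trans (_ : #|[set w | g w == (g y + -1)%R] :|: [set w | g w == (g y + 0)%R] :|:
      [set w | g w == (g y + 1)%R]| <= _)%N.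
      apply: subset_leq_card; apply/fintype.subsetP => w; rewrite !inE -/(g w) -/(g y); lia.
    apply: leq_trans (leq_card_setU _ _).1 _; rewrite leq_add2r.
    exact: (leq_card_setU _ _).1.
  have := N0 (-1); have := N0 0; have := N0 1.
  by do !case: ifPn; rewrite -?ltNge; lra.
rewrite big_mkcond /=; apply: (le_trans (ler_sum _ (fun y _ => key y))).
rewrite -mulr_sumr !big_split /= -!big_mkcond /=.
have := Ne (-1); have := Ne 0; have := Ne 1; lra.
Qed.

End Projection.

(** * Cones and pair energy *)

Section Cones.
Variables (R : realType) (T : finType) (X Y : T -> R).

(** Directions within 45 degrees of the first axis, so that slopes are at most 1 in size. The other
    directions are reached by exchanging [X] and [Y]. *)
Definition flat (y x : T) : bool := (X x != X y) && (`|Y x - Y y| <= `|X x - X y|).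

Definition slope (y x : T) : R := (Y x - Y y) / (X x - X y).

Definition cone (q : nat) (y x : T) : {set T} :=
  [set z | flat y z && (dyfloor q (slope y z) == dyfloor q (slope y x))].

Lemma slope_bound y x : flat y x -> `|slope y x| <= 1.
Proof.
move=> /andP[nz le]; rewrite /slope normrM normfV ler_pdivrMr ?mul1r //.
by rewrite normr_gt0 subr_eq0.
Qed.

Lemma dyfloor_slope_bound q y x : flat y x -> - (2 ^ q)%:Z <= dyfloor q (slope y x) <= (2 ^ q)%:Z.
Proof.
move/slope_bound; rewrite ler_norml => /andP[h1 h2].
have p0 : 0 < 2 ^+ q :> R by rewrite exprn_gt0.
have pe : ((2 ^ q)%:Z)%:~R = 2 ^+ q :> R by rewrite -natrX.
rewrite /dyfloor floor_ge_int rmorphN /= pe -(@mulrN1 _ (2 ^+ q)) ler_pM2l // h1 /=.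
rewrite -ltzD1 floor_lt_int rmorphD /= pe (@le_lt_trans _ _ (2 ^+ q)) ?ltrDl //.
by rewrite -[leRHS]mulr1 ler_pM2l.
Qed.

(** The cell of index 2^q begins at slope 1, which is why the grid of slopes has to run beyond 1. *)
Lemma card_slope_of_cell (q Q : nat) (a : int) :
  (q <= Q)%N -> - (2 ^ q)%:Z <= a <= (2 ^ q)%:Z ->
  (2 ^ (Q - q) <= #|[set k : 'I_(3 * 2 ^ Q) | dyfloor q (slope_of R Q k) == a]|)%N.
Proof.
move=> qQ /andP[a1 a2].
have eQ : (2 ^ Q = 2 ^ (Q - q) * 2 ^ q)%N by rewrite -expnD subnK.
have [b eb] : exists b : nat, b%:Z = a + (2 ^ q)%:Z.
  by exists `|(a + (2 ^ q)%:Z)%R|%N; lia.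
have bq : (b <= 2 * 2 ^ q)%N by lia.
have q0 : (0 < 2 ^ q)%N by rewrite expn_gt0.
have lt (i : 'I_(2 ^ (Q - q))) : (b * 2 ^ (Q - q) + i < 3 * 2 ^ Q)%N.
  by rewrite eQ; have := ltn_ord i; nia.
pose e i := Ordinal (lt i).
have ei : injective e.
  by move=> i j /(congr1 val) /= /addnI /val_inj.
rewrite -[leqLHS]card_ord -(card_imset _ ei) subset_leq_card //.
apply/fintype.subsetP => _ /imsetP[i _ ->]; rewrite inE; apply/eqP/dyfloor_itv.
have p0 n : 0 < 2 ^+ n :> R by rewrite exprn_gt0.
rewrite /slope_of /= natrD natrM natrX.
have -> : 2 ^+ Q = 2 ^+ (Q - q) * 2 ^+ q :> R by rewrite -exprD subnK.
have -> : a%:~R = b%:R - 2 ^+ q :> R.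
  by have := congr1 (fun z : int => z%:~R : R) eb; rewrite rmorphD /= -!pmulrn natrX => ->;
    rewrite addrK.
have il : i%:R < 2 ^+ (Q - q) :> R by rewrite -natrX ltr_nat.
have -> : 2 ^+ q * ((b%:R * 2 ^+ (Q - q) + i%:R) / (2 ^+ (Q - q) * 2 ^+ q) - 1) =
   b%:R - 2 ^+ q + i%:R / 2 ^+ (Q - q) :> R by field; rewrite !gt_eqF.
have i0 : 0 <= i%:R / 2 ^+ (Q - q) :> R by rewrite divr_ge0 // ltW.
have i1 : i%:R / 2 ^+ (Q - q) < 1 :> R by rewrite ltr_pdivrMr ?mul1r.
by rewrite lerDl i0 ltrD2l.
Qed.

(** This projection is constant along lines of slope [slope_of R Q k]. *)
Definition proj (Q k : nat) (z : T) : R := Y z - slope_of R Q k * X z.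

(** If the grid slope k lies in the slope cell of a cone with vertex [y], the projection along k
    sends the cone into the cell of [y] and its two neighbours. Each slope cell contains at least
    2^(Q-q) grid slopes, and for fixed [y] and k all the [x] counted lie in one cone. *)
Lemma heavy_cones_le (q Q : nat) (t : R) :
  0 < t -> (q <= Q)%N ->
  (forall z, 0 <= X z < 1) ->
  2 ^+ (Q - q) * \sum_y \sum_(x | flat y x && (t <= #|cone q y x|%:R)) (1 : R) <=
  \sum_(k < 3 * 2 ^ Q) \sum_(y | t <= #|[set w | `|dyfloor q (proj Q k w) - dyfloor q (proj Q k
    y)| <= 1]|%:R)
     #|[set w | `|dyfloor q (proj Q k w) - dyfloor q (proj Q k y)| <= 1]|%:R.
Proof.
move=> t0 qQ X01; set P := fun y x => flat y x && (t <= #|cone q y x|%:R).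
pose c (k : 'I_(3 * 2 ^ Q)) := dyfloor q (slope_of R Q k).
apply: (@le_trans _ _ (\sum_y \sum_(x | P y x) \sum_(k | c k == dyfloor q (slope y x)) (1 : R))).
  rewrite mulr_sumr; apply: ler_sum => y _.
  rewrite mulr_sumr; apply: ler_sum => x /andP[fx _].
  rewrite mulr1 -natrX -natr_card ler_nat; apply: card_slope_of_cell => //.
  exact: dyfloor_slope_bound.
under eq_bigr => y _ do rewrite (exchange_big_dep xpredT) //=.
rewrite exchange_big /=; apply: ler_sum => k _; rewrite [leRHS]big_mkcond /=.
apply: ler_sum => y _.
case: (pickP (fun x => P y x && (c k == dyfloor q (slope y x)))) => [x0 /andP[/andP[fx0 tx0]
  /eqP cx0]|none]; last first.
  by rewrite big_pred0 //; case: ifP.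
have sub : cone q y x0 \subset [set w | `|dyfloor q (proj Q k w) - dyfloor q (proj Q k y)| <= 1].
  apply/fintype.subsetP => z; rewrite !inE => /andP[fz /eqP ez].
  have := @dist_dyfloor R q 1 (proj Q k z) (proj Q k y) _; apply.
  move/andP: (fz) => [nz _].
  have nz' : X z - X y != 0 by rewrite subr_eq0.
  have -> : proj Q k z - proj Q k y = (slope y z - slope_of R Q k) * (X z - X y).
    by rewrite /proj /slope; field.
  rewrite normrM mulrC; apply: ler_pM => //.
    by have := X01 z; have := X01 y; rewrite ler_norml; lra.
  by apply/ltW/dyfloor_eq_dist; rewrite ez -cx0.
have le1 : t <= #|[set w | `|dyfloor q (proj Q k w) - dyfloor q (proj Q k y)| <= 1]|%:R.
  by apply: (le_trans tx0); rewrite ler_nat subset_leq_card.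
rewrite le1; apply: (@le_trans _ _ #|cone q y x0|%:R); last by rewrite ler_nat subset_leq_card.
rewrite natr_card.
rewrite [leRHS](bigID (fun x => P y x && (c k == dyfloor q (slope y x)))) /=.
apply: (@le_trans _ _ (\sum_(i | (flat y i && (dyfloor q (slope y i) == dyfloor q (slope y
  x0))) && (P y i && (c k == dyfloor q (slope y i)))) (1 : R))); last first.
  by rewrite lerDl sumr_ge0.
rewrite le_eqVlt; apply/orP; left; apply/eqP/eq_bigl => z.
rewrite -cx0 [dyfloor q (slope y z) == _]eq_sym /P.
by case: (flat y z); case: (c k == _); rewrite ?andbF.
Qed.

(** The sum over grid slopes of the squared L^2 norm of the projected counting measure, averaged on
    dyadic intervals of length 2^-q: the density on a cell is 2^q times its mass. *)
Definition pair_energy (Q q : nat) : R :=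
  2 ^+ q * \sum_(k < 3 * 2 ^ Q) \sum_z #|[set w | dyfloor q (proj Q k w) == dyfloor q (proj Q k
    z)]|%:R.

(** A fine cell of mass at least t / 3 satisfies 4 |T| <= 2^p mass by the hypothesis on [t], so it
    is much denser than its parent and is seen by the energy increment. The constant is 36 = 18 *
    2. *)
Lemma heavy_cones_le_energy (q p Q : nat) (t : R) :
  0 < t -> (q + p <= Q)%N -> (forall z, 0 <= X z < 1) ->
  12 * #|T|%:R <= 2 ^+ p * t ->
  2 ^+ Q * \sum_y \sum_(x | flat y x && (t <= #|cone (q + p) y x|%:R)) (1 : R) <=
  36 * (pair_energy Q (q + p) - pair_energy Q q).
Proof.
move=> t0 qQ X01 ht; have p0 n : 0 < 2 ^+ n :> R by rewrite exprn_gt0.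
pose m l (k : 'I_(3 * 2 ^ Q)) z : R := #|[set w | dyfloor l (proj Q k w) == dyfloor l (proj Q k
  z)]|%:R.
have S1 : 2 ^+ (Q - (q + p)) * \sum_y \sum_(x | flat y x && (t <= #|cone (q + p) y x|%:R)) (1 :
  R) <=
  \sum_(k < 3 * 2 ^ Q) 18 * (2 * \sum_z (m (q + p)%N k z - m q k z / 2 ^+ p)).
  apply: (le_trans (heavy_cones_le t0 qQ X01)); apply: ler_sum => k _.
  have e3 : t = 3 * (t / 3) by lra.
  rewrite {1}e3; apply: (le_trans (adj_le_mass _ _ _)); rewrite ler_pM2l //.
  apply: heavy_le_increment => z hz.
  have : #|[set w | dyfloor q (proj Q k w) == dyfloor q (proj Q k z)]|%:R <= #|T|%:R :> R.
    by rewrite ler_nat max_card.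
  move: hz; rewrite -(ler_pM2l (p0 p)) mulrA.
  set A := #|_|%:R; set B := #|_|%:R; lra.
have -> : 2 ^+ Q = 2 ^+ (q + p) * 2 ^+ (Q - (q + p)) :> R by rewrite -exprD subnKC.
rewrite -mulrA; apply: (le_trans (ler_wpM2l (ltW (p0 (q + p)%N)) S1)).
rewrite le_eqVlt; apply/orP; left; apply/eqP.
rewrite -!mulr_sumr /pair_energy.
under eq_bigr => k _ do rewrite sumrB -mulr_suml.
rewrite sumrB -mulr_suml exprD.
set A := \sum_(k < _) _; set B := \sum_(k < _) _.
by field; rewrite gt_eqF.
Qed.

Definition sqball (l : nat) (y : T) : {set T} :=
  [set z | (`|X z - X y| <= 2 ^- l) && (`|Y z - Y y| <= 2 ^- l)].

(** A discrete L^2 form of Marstrand's projection theorem. Points at distance about 2^-m share a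
    projected cell for a proportion of order 2^(m-q) of the slopes; with the Frostman bound the
    layers form a geometric series of ratio 2^(1-s), which converges because s > 1. *)
Lemma pair_energy_le (Q q : nat) (D : R) (s : R) :
  (q <= Q)%N -> (forall z, 0 <= X z < 1) -> (forall z, 0 <= Y z < 1) ->
  0 <= D -> 1 < s ->
  (forall i y, (i <= q)%N -> #|sqball i y|%:R <= D * 2 `^ (- (s * i%:R))) ->
  pair_energy Q q <= 24 / (1 - 2 `^ (1 - s)) * D * #|T|%:R * 2 ^+ Q.
Proof.
move=> qQ X01 Y01 D0 s1 HF; have p0 n : 0 < 2 ^+ n :> R by rewrite exprn_gt0.
have pair u v : \sum_(k < 3 * 2 ^ Q) (dyfloor q (proj Q k v) == dyfloor q (proj Q k u))%:R <=
    24 * 2 ^+ (Q - q) * \sum_(m < q.+1) 2 ^+ m * (v \in sqball m u)%:R :> R.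
  have dl : Num.max `|Y v - Y u| `|X u - X v| <= 2 ^- 0.
    rewrite expr0 invr1 ge_max !ler_norml.
    by have := X01 u; have := X01 v; have := Y01 u; have := Y01 v; lra.
  have := card_strip_slopes_layer (lexx 1) qQ dl.
  rewrite mulr1 => H; apply: (@le_trans _ _ (#|[set k : 'I_(3 * 2 ^ Q) | `|Y v - Y u + slope_of
    R Q k * (X u - X v)| <= 1 * 2 ^- (0 + q)]|%:R)).
    rewrite natr_card [leRHS]big_mkcond /=; apply: ler_sum => k _.
    case: eqP => [e|_]; last by case: ifP.
    have := dyfloor_eq_dist e; rewrite /proj mul1r add0n => h.
    rewrite ifT // ltW // (_ : _ + _ = Y v - slope_of R Q k * X v - (Y u - slope_of R Q k * X
      u)) //.
    by ring.
  apply: (le_trans H); rewrite ler_wpM2l // ?mulr_ge0 // ?(ltW (p0 _)) //.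
  apply: ler_sum => m _; rewrite ler_wpM2l ?(ltW (p0 _)) // add0n ge_max.
  by rewrite inE [ `|X u - _|]distrC andbC.
have E1 : \sum_(k < 3 * 2 ^ Q) \sum_z #|[set w | dyfloor q (proj Q k w) == dyfloor q (proj Q k
  z)]|%:R <=
   24 * 2 ^+ (Q - q) * \sum_(m < q.+1) 2 ^+ m * \sum_u #|sqball m u|%:R :> R.
  apply: (@le_trans _ _ (\sum_u \sum_v \sum_(k < 3 * 2 ^ Q) (dyfloor q (proj Q k v) == dyfloor
    q (proj Q k u))%:R)).
    rewrite exchange_big /=; apply: ler_sum => u _; rewrite exchange_big /=.
    apply: ler_sum => k _; rewrite natr_card big_mkcond /=; apply: ler_sum => v _.
    by case: eqP.
  apply: (le_trans (ler_sum _ (fun u _ => ler_sum _ (fun v _ => pair u v)))).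
  under eq_bigr => u _ do rewrite -mulr_sumr exchange_big /=.
  rewrite -mulr_sumr exchange_big /= ler_wpM2l // ?mulr_ge0 // ?(ltW (p0 _)) //.
  apply: ler_sum => m _; rewrite mulr_sumr; apply: ler_sum => u _.
  rewrite -mulr_sumr ler_wpM2l ?(ltW (p0 _)) // -sum1_card natr_sum.
  by rewrite [leRHS]big_mkcond /=; apply: ler_sum => v _; case: ifP.
pose x : R := 2 `^ (1 - s).
have x0 : 0 < x by apply: powR_gt0.
have x1 : x < 1.
  by rewrite /x /powR pnatr_eq0 /= expR_lt1 nmulr_rlt0 ?ln_gt0 ?subr_lt0 // ltr1n.
have E2 : \sum_(m < q.+1) 2 ^+ m * \sum_u #|sqball m u|%:R <= D * #|T|%:R / (1 - x).
  apply: (@le_trans _ _ (\sum_(m < q.+1) D * #|T|%:R * x ^+ m)).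
    apply: ler_sum => m _.
    apply: (@le_trans _ _ (2 ^+ m * \sum_(u : T) (D * 2 `^ (- (s * m%:R))))).
      rewrite ler_wpM2l ?(ltW (p0 _)) //; apply: ler_sum => u _; apply: HF.
      by rewrite -ltnS.
    rewrite sumr_const -[X in 2 ^+ m * X]mulr_natl.
    rewrite (_ : x ^+ m = 2 ^+ m * 2 `^ (- (s * m%:R))); first by rewrite le_eqVlt; apply/orP;
      left; apply/eqP; ring.
    rewrite /x -!powR_mulrn ?powR_ge0 // -powRrM -powRD ?pnatr_eq0 ?implybT //.
    by congr (_ `^ _); ring.
  rewrite -mulr_sumr ler_wpM2l ?mulr_ge0 //.
  rewrite -[leRHS]mul1r ler_pdivlMr ?subr_gt0 // mulrC.
  have := subrX1 x q.+1; have := exprn_ge0 q.+1 (ltW x0); lra.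
rewrite /pair_energy; apply: (le_trans (ler_wpM2l (ltW (p0 q)) E1)).
rewrite mulrA mulrCA -exprD subnKC //.
apply: (le_trans (ler_wpM2l _ E2)); first by rewrite mulr_ge0 // ltW.
by rewrite /x le_eqVlt; apply/orP; left; apply/eqP; ring.
Qed.

End Cones.

(** * Local strips *)

Lemma sum_mem_le_nimg (R : numDomainType) (T : finType) (U : eqType) (S : {set T}) (g : T -> U)
    (u : seq U) (b : pred U) :
  uniq u -> {in u, forall c, b c -> exists2 z, z \in S & g z = c} ->
  \sum_(c <- u) (b c)%:R <= (nimg S g)%:R :> R.
Proof.
move=> uu H; rewrite -natr_sum ler_nat.
have -> : (\sum_(c <- u) b c = size [seq c <- u | b c])%N.
  by rewrite size_filter -sum1_count [RHS]big_mkcond /=; apply: eq_bigr => c _; case: (b c).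
apply: uniq_leq_size; first exact: filter_uniq.
move=> c; rewrite mem_filter => /andP[bc cu]; have [z zS e] := H c cu bc.
by apply/mem_img; exists z.
Qed.

Lemma nimg_le_sum_mem (R : numDomainType) (T : finType) (U : eqType) (S : {set T}) (g : T -> U)
    (u : seq U) (b : pred U) :
  {in S, forall z, g z \in u /\ b (g z)} ->
  (nimg S g)%:R <= \sum_(c <- u) (b c)%:R :> R.
Proof.
move=> H; rewrite -natr_sum ler_nat.
have -> : (\sum_(c <- u) b c = size [seq c <- u | b c])%N.
  by rewrite size_filter -sum1_count [RHS]big_mkcond /=; apply: eq_bigr => c _; case: (b c).
by apply: nimg_le_size => z /H [h1 h2]; rewrite mem_filter h2 h1.
Qed.

Section Strips.
Variables (R : realType) (T : finType) (U : eqType) (X Y : T -> R).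
Variables (g : T -> U) (y : T) (S : {set T}) (l q : nat) (K s : R).
Hypothesis S_sqball : S \subset sqball X Y l y.
Hypothesis g_close : {in S &, forall z w, g z = g w ->
  `|X z - X w| <= 2 ^- (l + q) /\ `|Y z - Y w| <= 2 ^- (l + q)}.
Hypothesis cover : forall m, (m <= q)%N ->
  (nimg (sqball X Y (l + m) y) g)%:R <= K * 2 `^ (s * (q - m)%:R).
Hypothesis s1 : 1 <= s.

(** Pairs of a slope and a [g]-class in its strip are counted twice. A class in the layer 2^-(l+m)
    belongs to strips of order 2^m slopes, and there are at most K 2^(s(q-m)) such classes. As s >=
    1, each of the q + 1 layers contributes at most order K 2^(sq). *)
Lemma sum_strip_nimg (W : R) : 1 <= W ->
  \sum_(k < 3 * 2 ^ q) (nimg [set z in S | `|X z - X y + slope_of R q k * (Y z - Y y)| <= W * 2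
    ^- (l + q)] g)%:R
  <= 24 * (W + 3) * (K * q.+1%:R * 2 `^ (s * q%:R)) :> R.
Proof.
move=> W1; have p0 n : 0 < 2 ^+ n :> R by rewrite exprn_gt0.
set u := undup [seq g z | z <- enum S].
have uu : uniq u by apply: undup_uniq.
pose rep c := odflt y [pick z | (z \in S) && (g z == c)].
have repP c : c \in u -> rep c \in S /\ g (rep c) = c.
  move/mem_img => [z zS e]; rewrite /rep; case: pickP => [w /andP[wS /eqP //]|/(_ z)].
  by rewrite zS e eqxx.
pose St (k : nat) (w : R) z := `|X z - X y + slope_of R q k * (Y z - Y y)| <= w * 2 ^- (l + q).
pose near_rep m c := rep c \in sqball X Y (l + m) y.
apply: (@le_trans _ _ (\sum_(c <- u) 24 * (W + 3) * \sum_(m < q.+1) 2 ^+ m * (near_rep m c)%:R)).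
  apply: (@le_trans _ _ (\sum_(c <- u) \sum_(k < 3 * 2 ^ q) ((c \in u) && St k (W + 3) (rep
    c))%:R)).
    rewrite exchange_big /=; apply: ler_sum => k _.
    apply: nimg_le_sum_mem => z; rewrite inE => /andP[zS zk].
    have gu : g z \in u by apply/mem_img; exists z.
    split=> //; rewrite gu /=.
    have [rS re] := repP _ gu; have [h1 h2] := g_close rS zS re.
    have a2 := slope_of_bound R (ltn_ord k).
    rewrite /St; set r := rep (g z) in rS re h1 h2 *.
    (* Replacing a point by its representative moves each coordinate by at most 2^-(l+q); slopes
       being at most 2 in size, the strip widens from [W] to [W + 3]. *)
    have -> : X r - X y + slope_of R q k * (Y r - Y y) =
      (X z - X y + slope_of R q k * (Y z - Y y)) + ((X r - X z) + slope_of R q k * (Y r - Y z))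
        by ring.
    apply: (le_trans (ler_normD _ _)); rewrite [leRHS]mulrDl lerD //.
    apply: (le_trans (ler_normD _ _)); rewrite normrM.
    have : `|slope_of R q k| * `|Y r - Y z| <= 2 * 2 ^- (l + q) by apply: ler_pM.
    lra.
  rewrite big_seq [leRHS]big_seq; apply: ler_sum => c cu.
  have [rS _] := repP _ cu.
  have rl : Num.max `|X (rep c) - X y| `|Y (rep c) - Y y| <= 2 ^- l.
    by have := fintype.subsetP S_sqball _ rS; rewrite inE ge_max.
  have W3 : 1 <= W + 3 by lra.
  have := card_strip_slopes_layer W3 (leqnn q) rl.
  rewrite subnn expr0 mulr1 => H.
  apply: le_trans (_ : _ <= #|[set k : 'I_(3 * 2 ^ q) | St k (W + 3) (rep c)]|%:R) _.
    by rewrite natr_card [leRHS]big_mkcond /= cu; apply: ler_sum => k _; case: (St _ _ _).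
  apply: (le_trans H); rewrite ler_wpM2l; [by []|lra|].
  apply: ler_sum => m _; rewrite ler_wpM2l ?(ltW (p0 _)) // ge_max.
  by rewrite /near_rep inE.
rewrite -mulr_sumr ler_wpM2l; [by []|lra|].
rewrite exchange_big /=.
apply: (@le_trans _ _ (\sum_(m < q.+1) K * 2 `^ (s * q%:R))); last first.
  rewrite sumr_const card_ord -[X in X <= _]mulr_natr le_eqVlt.
  by apply/orP; left; apply/eqP; ring.
apply: ler_sum => m _; have mq : (m <= q)%N by rewrite -ltnS.
rewrite -mulr_sumr.
have c1 : \sum_(c <- u) (near_rep m c)%:R <= (nimg (sqball X Y (l + m) y) g)%:R :> R.
  by apply: sum_mem_le_nimg => // c /repP[_ e] h; exists (rep c).
apply: (le_trans (ler_wpM2l (ltW (p0 m)) (le_trans c1 (cover mq)))).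
have K0 : 0 <= K.
  have := cover (leq0n q); have := ler0n R (nimg (sqball X Y (l + 0) y) g).
  by move=> h1 h2; have := le_trans h1 h2; rewrite pmulr_lge0 // powR_gt0.
rewrite mulrCA ler_wpM2l // -powR_mulrn // -powRD ?pnatr_eq0 ?implybT //.
rewrite ler_powR ?ler1n // natrB // mulrBr.
have : 0 <= (s - 1) * m%:R by rewrite mulr_ge0 // subr_ge0.
lra.
Qed.

End Strips.

Definition dst (R : realType) (T : finType) (X Y : T -> R) (x z : T) : R :=
  Num.sqrt ((X z - X x) ^+ 2 + (Y z - Y x) ^+ 2).

Section Light.
Variables (R : realType) (T : finType) (X Y : T -> R).
Hypothesis X01 : forall z, 0 <= X z < 1.
Hypothesis Y01 : forall z, 0 <= Y z < 1.

Lemma dst_le2 x z : dst X Y x z <= 2.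
Proof.
have := X01 x; have := X01 z; have := Y01 x; have := Y01 z => h1 h2 h3 h4.
rewrite /dst -[leRHS]ger0_norm // -sqrtr_sqr ler_sqrt ?sqr_ge0 //; nra.
Qed.

(* Differences of squared distances are quadratic polynomials, so no square
   root has to be linearised. *)
Lemma dst_linear (l q m0 : nat) (x y z : T) (a : R) :
  (q <= l)%N -> 2 ^- m0 <= `|X x - X y| ->
  z \in sqball X Y l y -> `|dst X Y x z - dst X Y x y| <= 2 ^- (l + q) ->
  `|slope X Y y x - a| <= 2 ^- q ->
  `|X z - X y + a * (Y z - Y y)| <= (3 * 2 ^+ m0 + 1) * 2 ^- (l + q).
Proof.
move=> ql far; rewrite inE => /andP[hx hy] hd ha.
have p0 n : 0 < 2 ^+ n :> R by rewrite exprn_gt0.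
have d20 := dst_le2 x z; have d21 := dst_le2 x y.
have dge (w : T) : 0 <= dst X Y x w by apply: sqrtr_ge0.
have dsq w : dst X Y x w ^+ 2 = (X w - X x) ^+ 2 + (Y w - Y x) ^+ 2.
  by rewrite sqr_sqrtr // addr_ge0 ?sqr_ge0.
set h := X z - X y in hx *; set v := Y z - Y y in hy *.
set p := X x - X y in far; set r := Y x - Y y.
have pn0 : p != 0 by rewrite -normr_gt0 (lt_le_trans _ far) // invr_gt0.
have main : 2 * (p * h + r * v) = h ^+ 2 + v ^+ 2 -
    (dst X Y x z - dst X Y x y) * (dst X Y x z + dst X Y x y).
  have -> : (dst X Y x z - dst X Y x y) * (dst X Y x z + dst X Y x y) =
     dst X Y x z ^+ 2 - dst X Y x y ^+ 2 by ring.
  by rewrite !dsq /h /v /p /r; ring.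
(* Here [q <= l] enters: the curvature of the circle around [x] is invisible at scale 2^-(l+q). *)
have lq : 2 ^- l * 2 ^- l <= 2 ^- (l + q) :> R.
  by rewrite -invfM -exprD lef_pV2 ?posrE // ler_weXn2l ?ler1n // leq_add2l.
have h2 : `|h ^+ 2| <= 2 ^- (l + q).
  by rewrite normrX expr2; apply: le_trans lq; apply: ler_pM.
have v2 : `|v ^+ 2| <= 2 ^- (l + q).
  by rewrite normrX expr2; apply: le_trans lq; apply: ler_pM.
have dd : `|(dst X Y x z - dst X Y x y) * (dst X Y x z + dst X Y x y)| <= 2 ^- (l + q) * 4.
  rewrite normrM; apply: ler_pM => //; rewrite ger0_norm ?addr_ge0 //; lra.
have sz : `|p * h + r * v| <= 3 * 2 ^- (l + q).
  move: main h2 v2 dd; set A := p * h + r * v; set B := (_ - _) * (_ + _).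
  by rewrite !ler_norml; lra.
have e : h + slope X Y y x * v = (p * h + r * v) / p by rewrite /slope -/p -/r; field.
have -> : h + a * v = (p * h + r * v) / p - (slope X Y y x - a) * v by rewrite -e; ring.
apply: (le_trans (ler_normB _ _)); rewrite [leRHS]mulrDl mul1r; apply: lerD.
  rewrite normrM normfV ler_pdivrMr ?normr_gt0 //; apply: (le_trans sz).
  have : 1 <= 2 ^+ m0 * `|p|.
    by move: far; rewrite -(ler_pM2l (p0 m0)) mulfV // gt_eqF.
  move=> far1; rewrite -(mulrA 3) [2 ^+ m0 * _]mulrC -!mulrA ler_pM2l // ler_peMr // invr_ge0
    ltW //.
rewrite normrM exprD invfM mulrC; exact: ler_pM.
Qed.

Variables (U : eqType) (g : T -> U) (y : T) (S : {set T}) (l q : nat) (K s : R).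
Hypothesis S_sqball : S \subset sqball X Y l y.
Hypothesis g_close : {in S &, forall z w, g z = g w ->
  `|X z - X w| <= 2 ^- (l + q) /\ `|Y z - Y w| <= 2 ^- (l + q)}.
Hypothesis cover : forall m, (m <= q)%N ->
  (nimg (sqball X Y (l + m) y) g)%:R <= K * 2 `^ (s * (q - m)%:R).
Hypothesis s1 : 1 <= s.

Definition fiber (x : T) : {set T} :=
  [set z in S | dyfloor (l + q) (dst X Y x z) == dyfloor (l + q) (dst X Y x y)].

(** For [x] in a given slope cell, [fiber x] lies in one strip through [y] orthogonal to that slope,
    so this strip meets at least [b] classes. The double count leaves few such slopes, and each
    light cone holds at most [t] points. *)
Lemma light_bad_le (m0 : nat) (b t : R) : (q <= l)%N -> 0 < b -> 0 <= t ->
  \sum_(x | [&& flat X Y y x, 2 ^- m0 <= `|X x - X y|, b <= (nimg (fiber x) g)%:R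
              & #|cone X Y q y x|%:R <= t]) (1 : R)
  <= t / b * (168 * 2 ^+ m0 * (K * q.+1%:R * 2 `^ (s * q%:R))).
Proof.
move=> ql b0 t0.
pose P x := [&& flat X Y y x, 2 ^- m0 <= `|X x - X y|, b <= (nimg (fiber x) g)%:R
              & #|cone X Y q y x|%:R <= t].
rewrite -[leLHS]/(\sum_(x | P x) 1).
have p0 n : 0 < 2 ^+ n :> R by rewrite exprn_gt0.
pose W : R := 3 * 2 ^+ m0 + 1.
pose St (k : nat) := [set z in S | `|X z - X y + slope_of R q k * (Y z - Y y)| <= W * 2 ^- (l +
  q)].
have m01 : 1 <= 2 ^+ m0 :> R by rewrite exprn_ege1 // ler1n.
have W1 : 1 <= W by rewrite /W; lra.
apply: (@le_trans _ _ (\sum_(k < 3 * 2 ^ q) t / b * (nimg (St k) g)%:R)); last first.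
  rewrite -mulr_sumr ler_wpM2l ?divr_ge0 ?(ltW b0) //.
  apply: (le_trans (sum_strip_nimg S_sqball g_close cover s1 W1)).
  have K0 : 0 <= K * q.+1%:R * 2 `^ (s * q%:R).
    have := cover (leq0n q); have := ler0n R (nimg (sqball X Y (l + 0) y) g).
    move=> h1 h2; have := le_trans h1 h2; rewrite pmulr_lge0 ?powR_gt0 // => K0.
    by rewrite !mulr_ge0 ?powR_ge0.
  (* Here 24 (W + 3) = 24 (3 * 2^m0 + 4) is at most 168 * 2^m0. *)
  rewrite ler_wpM2r //; rewrite /W; lra.
pose c (k : 'I_(3 * 2 ^ q)) := dyfloor q (slope_of R q k).
apply: (@le_trans _ _ (\sum_(x | P x) \sum_(k | c k == dyfloor q (slope X Y y x)) (1 : R))).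
  apply: ler_sum => x /and4P[fx _ _ _].
  rewrite -natr_card -[leLHS]/(1%:R) ler_nat.
  have := card_slope_of_cell R (leqnn q) (dyfloor_slope_bound q fx).
  by rewrite subnn expn0.
rewrite (exchange_big_dep xpredT) //=; apply: ler_sum => k _.
case: (pickP (fun x => P x && (c k == dyfloor q (slope X Y y x)))) => [x0 /andP[/and4P[fx0 far0
  bx0 tx0] /eqP cx0]|none]; last first.
  by rewrite big_pred0 // mulr_ge0 // divr_ge0 // ltW.
have sub : fiber x0 \subset St k.
  apply/fintype.subsetP => z; rewrite !inE => /andP[zS /eqP ez]; rewrite zS /=.
  apply: (dst_linear ql far0).
  - exact: (fintype.subsetP S_sqball).
  - exact/ltW/dyfloor_eq_dist.
  - by apply/ltW/dyfloor_eq_dist; rewrite -cx0.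
apply: (@le_trans _ _ t); last first.
  rewrite -mulrA -[leLHS]mulr1 ler_wpM2l // [b^-1 * _]mulrC ler_pdivlMr // mul1r.
  by apply: (le_trans bx0); rewrite ler_nat nimgS.
apply: le_trans tx0; rewrite -natr_card ler_nat subset_leq_card //.
apply/fintype.subsetP => x; rewrite !inE => /andP[/and4P[-> _ _ _] /eqP <-] /=.
by rewrite -cx0.
Qed.

End Light.

(** * Dyadic squares *)

Definition cell (R : realType) (T : finType) (X Y : T -> R) (l : nat) (z : T) : int * int :=
  (dyfloor l (X z), dyfloor l (Y z)).

Section Cells.
Variables (R : realType) (T : finType) (X Y : T -> R).

Lemma cell_sqball l y : [set z | cell X Y l z == cell X Y l y] \subset sqball X Y l y.
Proof.
apply/fintype.subsetP => z; rewrite !inE => /eqP[e1 e2].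
by apply/andP; split; apply/ltW/dyfloor_eq_dist.
Qed.

Lemma cell_refine l p z w : cell X Y (l + p) z = cell X Y (l + p) w -> cell X Y l z = cell X Y
  l w.
Proof. by move=> [/dyfloor_refine e1 /dyfloor_refine e2]; rewrite /cell e1 e2. Qed.

Lemma dst_lipschitz x z y :
  `|dst X Y x z - dst X Y x y| <= `|X z - X y| + `|Y z - Y y|.
Proof.
have half a b : dst X Y x a <= dst X Y x b + (`|X a - X b| + `|Y a - Y b|).
  have d0 : 0 <= dst X Y x b by apply: sqrtr_ge0.
  have dsq : dst X Y x b ^+ 2 = (X b - X x) ^+ 2 + (Y b - Y x) ^+ 2.
    by rewrite sqr_sqrtr // addr_ge0 ?sqr_ge0.
  set e := `|X a - X b| + `|Y a - Y b|.
  have e0 : 0 <= e by apply: addr_ge0.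
  rewrite {1}/dst -[leRHS]ger0_norm ?addr_ge0 // -sqrtr_sqr ler_sqrt ?sqr_ge0 //.
  have leX : `|X b - X x| <= dst X Y x b.
    by rewrite -sqrtr_sqr ler_wsqrtr // lerDl sqr_ge0.
  have leY : `|Y b - Y x| <= dst X Y x b.
    by rewrite -[ `|Y b - _|]sqrtr_sqr ler_wsqrtr // lerDr sqr_ge0.
  have -> : (X a - X x) ^+ 2 + (Y a - Y x) ^+ 2 = dst X Y x b ^+ 2 +
     2 * ((X b - X x) * (X a - X b) + (Y b - Y x) * (Y a - Y b)) +
     ((X a - X b) ^+ 2 + (Y a - Y b) ^+ 2) by rewrite dsq; ring.
  have c1 : (X b - X x) * (X a - X b) <= dst X Y x b * `|X a - X b|.
    by apply: (le_trans (ler_norm _)); rewrite normrM ler_wpM2r.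
  have c2 : (Y b - Y x) * (Y a - Y b) <= dst X Y x b * `|Y a - Y b|.
    by apply: (le_trans (ler_norm _)); rewrite normrM ler_wpM2r.
  have c3 : (X a - X b) ^+ 2 + (Y a - Y b) ^+ 2 <= e ^+ 2.
    rewrite /e -(real_normK (num_real (X a - X b))) -(real_normK (num_real (Y a - Y b))).
    have := normr_ge0 (X a - X b); have := normr_ge0 (Y a - Y b); nra.
  by rewrite sqrrD; move: c1 c2 c3; rewrite /e; set D := dst X Y x b; lra.
rewrite ler_norml; have := half z y; have := half y z.
rewrite [ `|X y - _|]distrC [ `|Y y - _|]distrC; lra.
Qed.

Variables (K s : R) (N : nat).
Hypothesis K1 : 1 <= K.
Hypothesis s0 : 0 <= s.
Hypothesis X01 : forall z, 0 <= X z < 1.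
Hypothesis Y01 : forall z, 0 <= Y z < 1.
Hypothesis cover : forall l p y, (l + p <= N)%N ->
  (nimg (sqball X Y l y) (cell X Y (l + p)))%:R <= K * 2 `^ (s * p%:R).
Hypothesis leaf : forall y, #|[set z | cell X Y N z == cell X Y N y]|%:R <= K.

Lemma sqball0 y : sqball X Y 0 y = [set: T].
Proof.
apply/setP => z; rewrite !inE expr0 invr1 !ler_norml.
by have := X01 y; have := X01 z; have := Y01 y; have := Y01 z => *; apply/andP; split; lra.
Qed.

(* The branching of the fibres of the distance to x between scales l and
   l + q, as seen from y. *)
Definition nloc (l q : nat) (x y : T) : nat :=
  nimg [set z | (cell X Y l z == cell X Y l y) &&
     (dyfloor (l + q) (dst X Y x z) == dyfloor (l + q) (dst X Y x y))] (cell X Y (l + q)).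

Lemma nloc_gt0 l q x y : (0 < nloc l q x y)%N.
Proof. by apply: (@nimg_gt0 _ _ _ _ y); rewrite inE !eqxx. Qed.

Lemma nloc_le l q x y : (l + q <= N)%N -> (nloc l q x y)%:R <= K * 2 `^ (s * q%:R).
Proof.
move=> /cover H; apply: le_trans (H y); rewrite ler_nat nimgS //.
apply: fintype.subset_trans (cell_sqball l y).
by apply/fintype.subsetP => z; rewrite !inE => /andP[].
Qed.

Lemma card_cell_le l y : (l <= N)%N ->
  #|[set z | cell X Y l z == cell X Y l y]|%:R <= K * 2 `^ (s * (N - l)%:R) * K.
Proof.
move=> lN; set S := [set z | _].
apply: (@le_trans _ _ ((nimg S (cell X Y N))%:R * K)).
  apply: card_le_nimg => y0 _; apply: le_trans (leaf y0).
  by rewrite ler_nat subset_leq_card //; apply/fintype.subsetP => z; rewrite !inE => /andP[].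
rewrite ler_wpM2r ?(le_trans ler01 K1) //.
have := @cover l (N - l) y; rewrite subnKC // => /(_ (leqnn _)).
by apply: le_trans; rewrite ler_nat nimgS // cell_sqball.
Qed.

(** The blocks start at the scale q and not at 0, because linearising the distance on a block from l
    to l + q requires q <= l. The scales before the first block and after the last one cost the
    terms in [ln K] and in [s * q]. *)
Lemma entropy_at (q M : nat) (x : T) :
  (M.+1 * q <= N)%N -> (N <= M.+1 * q + q)%N ->
  #|T|%:R * ln #|T|%:R <= #|T|%:R * (3 * ln K + 2 * (s * q%:R * ln 2) +
     ln (nimg [set: T] (fun z => dyfloor N (dst X Y x z)))%:R + M%:R * ln 5)
   + \sum_(j < M) \sum_y ln (nloc (j.+1 * q) q x y)%:R :> R.
Proof.
move=> MN NM; pose L (j : nat) := (j.+1 * q)%N.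
have LS j : L j.+1 = (L j + q)%N by rewrite /L mulSn addnC.
have n0 : 0 < #|T|%:R :> R by rewrite ltr0n; apply/card_gt0P; exists x.
have ln2 : 0 <= ln 2 :> R by rewrite ln_ge0 // ler1n.
have lnK0 : 0 <= ln K by rewrite ln_ge0.
pose a j y : R := #|[set z | cell X Y (L j) z == cell X Y (L j) y]|%:R.
have chain := @entropy_chain R T _ _ (fun j => cell X Y (L j))
  (fun j z => dyfloor (L j) (dst X Y x z)) M 5.
have ref j z w : dyfloor (L j.+1) (dst X Y x z) = dyfloor (L j.+1) (dst X Y x w) ->
   dyfloor (L j) (dst X Y x z) = dyfloor (L j) (dst X Y x w).
  (* The constant 5 bounds the dyadic indices taken by the distance on one square: distances there
     differ by at most 2 * 2^-(L j), so indices differ by at most 2 from a given one. *)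
  by rewrite LS; apply: dyfloor_refine.
have five j y : (nimg [set z | cell X Y (L j) z == cell X Y (L j) y]
     (fun z => dyfloor (L j) (dst X Y x z)) <= 5)%N.
  apply: (@nimg_int _ _ _ (dyfloor (L j) (dst X Y x y) - 2)) => z zc.
  have := fintype.subsetP (cell_sqball (L j) y) z zc; rewrite inE => /andP[h1 h2].
  have : `|dst X Y x z - dst X Y x y| <= 2%:R * 2 ^- (L j).
    by apply: (le_trans (dst_lipschitz _ _ _)); lra.
  by move=> /dist_dyfloor; clear; rewrite /=; lia.
have {}chain := chain ref five.
have A0 : \sum_y (ln #|T|%:R - ln (a 0%N y)) <= #|T|%:R * (ln K + s * q%:R * ln 2).
  apply: (le_trans (sum_ln_class_le R (cell X Y (L 0)))); rewrite ler_wpM2l ?(ltW n0) //.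
  have := @cover 0 q x; rewrite sqball0 add0n => /(_ _) H.
  have {}H : (nimg [set: T] (cell X Y (L 0)))%:R <= K * 2 `^ (s * q%:R).
    by rewrite /L mul1n; apply: H; move: MN; rewrite mulSn; lia.
  have K0 : 0 < K := lt_le_trans ltr01 K1.
  rewrite -ln_powR -lnM ?posrE ?powR_gt0 // ler_ln ?posrE ?mulr_gt0 ?powR_gt0 //.
  by rewrite ltr0n (@nimg_gt0 _ _ _ _ x) ?inE.
have AM y : ln (a M y) <= 2 * ln K + s * q%:R * ln 2.
  have K0 : 0 < K := lt_le_trans ltr01 K1.
  rewrite (_ : 2 * ln K + s * q%:R * ln 2 = ln (K * 2 `^ (s * q%:R) * K)); last first.
    by rewrite !lnM ?posrE ?mulr_gt0 ?powR_gt0 // ln_powR; ring.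
  rewrite ler_ln ?posrE ?mulr_gt0 ?powR_gt0 ?ltr0n ?card_class_gt0 //.
  apply: (le_trans (card_cell_le y MN)); rewrite ler_pM2r // ler_pM2l //.
  rewrite ler_powR ?ler1n // ler_wpM2l // ler_nat; lia.
have I1 : ln (nimg [set: T] (fun z => dyfloor (L M) (dst X Y x z)))%:R <=
   ln (nimg [set: T] (fun z => dyfloor N (dst X Y x z)))%:R :> R.
  rewrite ler_ln ?posrE ?ltr0n ?(@nimg_gt0 _ _ _ _ x) ?inE // ler_nat.
  apply: nimg_factor => z w _ _; rewrite -(subnKC MN); exact: dyfloor_refine.
have SM : \sum_y ln (a M y) <= #|T|%:R * (2 * ln K + s * q%:R * ln 2).
  by rewrite mulr_natl -sumr_const; apply: ler_sum.
have E : \sum_y (ln (a 0%N y) - ln (a M y)) = #|T|%:R * ln #|T|%:R -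
   \sum_y (ln #|T|%:R - ln (a 0%N y)) - \sum_y ln (a M y).
  have e1 : \sum_(y : T) ln (#|T|%:R : R) = #|T|%:R * ln #|T|%:R.
    by rewrite sumr_const -[LHS]mulr_natl.
  by rewrite !sumrB e1; ring.
move: chain; rewrite /= E.
under eq_bigr => j _ do rewrite LS.
rewrite [X in _ <= _ + X -> _]big_split /= sumr_const card_ord.
have := ler_wpM2l (ltW n0) I1.
rewrite -[_ *+ M]mulr_natl /nloc; lra.
Qed.

End Cells.

(** * Bad pairs *)

Section Swap.
Variables (R : realType) (T : finType).
Implicit Types X Y : T -> R.

Lemma dstC X Y x z : dst Y X x z = dst X Y x z.
Proof. by rewrite /dst addrC. Qed.

Lemma sqballC X Y l y : sqball Y X l y = sqball X Y l y.
Proof. by apply/setP => z; rewrite !inE andbC. Qed.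

Lemma flat_or X Y y x : [|| flat X Y y x, flat Y X y x | (X x == X y) && (Y x == Y y)].
Proof.
rewrite /flat; case: (eqVneq (X x) (X y)) => [e1|n1]; case: (eqVneq (Y x) (Y y)) => [e2|n2];
  rewrite ?andbF ?andbT ?orbT //=.
  by rewrite e1 subrr normr0 normr_ge0.
  by rewrite e2 subrr normr0 normr_ge0.
by rewrite orbF; apply: le_total.
Qed.

Lemma sum_split_or (P P1 P2 : pred T) :
  (forall x, P x -> P1 x || P2 x) ->
  \sum_(x | P x) (1 : R) <= \sum_(x | P1 x) 1 + \sum_(x | P2 x) 1.
Proof.
move=> H; rewrite big_mkcond [X in X + _]big_mkcond [X in _ + X]big_mkcond -big_split /=.
apply: ler_sum => x _; have := H x.
by case: (P x); case: (P1 x); case: (P2 x) => //= h; first [lra | have := h isT].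
Qed.

End Swap.

Section BadPairs.
Variables (R : realType) (T : finType) (X Y : T -> R) (K s s' al : R) (N : nat).
Hypothesis s1 : 1 <= s.
Hypothesis X01 : forall z, 0 <= X z < 1.
Hypothesis Y01 : forall z, 0 <= Y z < 1.
Hypothesis cover : forall l p y, (l + p <= N)%N ->
  (nimg (sqball X Y l y) (cell X Y (l + p)))%:R <= K * 2 `^ (s * p%:R).
Hypothesis frost : forall i y, (i <= N)%N ->
  #|sqball X Y i y|%:R <= 9 * 2 `^ (- (s' * i%:R)) * #|T|%:R.

(* A bad pair has thr q ~ 2 ^ ((s - t') q) squares in its strip, t' = 1 - 2 al;
   a cone is heavy when its mass exceeds the fraction 2 ^ (- (1 - al) q). *)
Let thr (q : nat) : R := 2 `^ ((s - 1 + 2 * al) * q%:R).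
Let tau (q : nat) : R := 2 `^ (- ((1 - al) * q%:R)) * #|T|%:R.

Definition bad (l q : nat) (y x : T) : bool := thr q <= (nloc X Y l q x y)%:R.

(** The exponents of [thr] and [tau] are balanced so that tau / thr * 2^(sq) = 2^(- al q) |T|, a
    gain exponential in q. Both orders of the coordinates are treated at once. *)
Lemma light_sum_le (l q m0 : nat) (y : T) (X' Y' : T -> R) :
  (X' = X /\ Y' = Y) \/ (X' = Y /\ Y' = X) ->
  (q <= l)%N -> (l + q <= N)%N ->
  \sum_(x | [&& flat X' Y' y x, 2 ^- m0 <= `|X' x - X' y|, bad l q y x
              & #|cone X' Y' q y x|%:R <= tau q]) (1 : R)
  <= 168 * 2 ^+ m0 * K * q.+1%:R * 2 `^ (- (al * q%:R)) * #|T|%:R.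
Proof.
move=> sw ql lqN; pose S := [set z | cell X Y l z == cell X Y l y].
have X'01 z : 0 <= X' z < 1 by case: sw => -[-> _].
have Y'01 z : 0 <= Y' z < 1 by case: sw => -[_ ->].
have nn i w : sqball X' Y' i w = sqball X Y i w by case: sw => -[-> ->] //; rewrite sqballC.
have dd a b : dst X' Y' a b = dst X Y a b by case: sw => -[-> ->] //; rewrite dstC.
have S_sqball : S \subset sqball X' Y' l y by rewrite nn cell_sqball.
have gc : {in S &, forall z w, cell X Y (l + q) z = cell X Y (l + q) w ->
  `|X' z - X' w| <= 2 ^- (l + q) /\ `|Y' z - Y' w| <= 2 ^- (l + q)}.
  move=> z w _ _ e.
  have : z \in sqball X' Y' (l + q) w.
    by rewrite nn; apply: (fintype.subsetP (cell_sqball X Y (l + q) w)); rewrite inE e.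
  by rewrite inE => /andP.
have cov m : (m <= q)%N ->
  (nimg (sqball X' Y' (l + m) y) (cell X Y (l + q)))%:R <= K * 2 `^ (s * (q - m)%:R).
  move=> mq; rewrite nn; have := @cover (l + m) (q - m) y.
  by rewrite -addnA subnKC //; apply.
have fb x : nimg (fiber X' Y' y S l q x) (cell X Y (l + q)) = nloc X Y l q x y.
  by rewrite /nloc; congr nimg; apply/setP => z; rewrite !inE !dd.
have b0 : 0 < thr q by apply: powR_gt0.
have t0 : 0 <= tau q by rewrite mulr_ge0 // powR_ge0.
have := light_bad_le X'01 Y'01 S_sqball gc cov s1 m0 ql b0 t0.
under eq_bigl => x do rewrite fb.
move=> H; apply: (le_trans H); rewrite le_eqVlt; apply/orP; left; apply/eqP.
have e : tau q / thr q * 2 `^ (s * q%:R) = 2 `^ (- (al * q%:R)) * #|T|%:R.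
  have aux (A n B C : R) : A * n * B * C = A * B * C * n by ring.
  rewrite /tau /thr -powRN aux -!powRD ?pnatr_eq0 ?implybT //.
  by congr (_ `^ _ * _); ring.
have -> : tau q / thr q * (168 * 2 ^+ m0 * (K * q.+1%:R * 2 `^ (s * q%:R))) =
  168 * 2 ^+ m0 * K * q.+1%:R * (tau q / thr q * 2 `^ (s * q%:R)) by ring.
by rewrite e !mulrA.
Qed.

(** The three contributions come from close pairs, from light cones (336 = 2 * 168, for the two
    orders of coordinates) and from heavy cones. The condition on 12 * 2^q says that [tau (q + p)]
    is large enough for the energy increment from q to q + p to see the heavy cones. *)
Lemma bad_pairs_le (l q p Q m0 : nat) :
  (q + p <= l)%N -> (l + (q + p) <= N)%N -> (q + p <= Q)%N -> (m0 <= N)%N ->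
  12 * 2 ^+ q <= 2 `^ (al * (q + p)%:R) ->
  \sum_y \sum_(x | bad l (q + p) y x) (1 : R) <=
  (9 * 2 `^ (- (s' * m0%:R)) +
   336 * 2 ^+ m0 * K * (q + p).+1%:R * 2 `^ (- (al * (q + p)%:R))) * #|T|%:R ^+ 2 +
  36 / 2 ^+ Q * ((pair_energy X Y Q (q + p) - pair_energy X Y Q q) +
                 (pair_energy Y X Q (q + p) - pair_energy Y X Q q)).
Proof.
move=> ql lN qQ mN h12; have p0 n : 0 < 2 ^+ n :> R by rewrite exprn_gt0.
case: (pickP (@predT T)) => [y0 _|none]; last first.
  have pe X' Y' k : @pair_energy R T X' Y' Q k = 0.
    by rewrite /pair_energy big1 ?mulr0 // => j _; rewrite big_pred0.
  set c := 9 * _ + _; have -> : #|T| = 0%N by apply: eq_card0.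
  by rewrite !pe big_pred0 // expr0n mulr0 !subrr addr0 mulr0 addr0.
have n0 : 0 < #|T|%:R :> R by rewrite ltr0n; apply/card_gt0P; exists y0.
set t := tau (q + p).
have t0 : 0 < t by rewrite mulr_gt0 // powR_gt0.
have ht : 12 * #|T|%:R <= 2 ^+ p * t.
  rewrite /t /tau mulrA ler_pM2r // -(ler_pM2l (p0 q)) mulrA -exprD.
  rewrite -(powR_mulrn (q + p)) // -powRD ?pnatr_eq0 ?implybT //.
  rewrite mulrC (_ : _ + _ = al * (q + p)%:R) //; ring.
have heavy (X' Y' : T -> R) : (forall z, 0 <= X' z < 1) ->
  \sum_y \sum_(x | flat X' Y' y x && (t <= #|cone X' Y' (q + p) y x|%:R)) (1 : R) <=
  36 / 2 ^+ Q * (pair_energy X' Y' Q (q + p) - pair_energy X' Y' Q q).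
  move=> X'01; have := @heavy_cones_le_energy R T X' Y' q p Q t t0 qQ X'01 ht.
  by rewrite mulrC -ler_pdivlMr // => H; apply: (le_trans H); rewrite mulrAC.
pose L (X' Y' : T -> R) y x := [&& flat X' Y' y x, 2 ^- m0 <= `|X' x - X' y|, bad l (q + p) y x
              & #|cone X' Y' (q + p) y x|%:R <= t].
pose H (X' Y' : T -> R) y x := flat X' Y' y x && (t <= #|cone X' Y' (q + p) y x|%:R).
(* A bad pair is close, or its direction is light for y, or its cone is heavy. *)
have cls y x : bad l (q + p) y x -> (x \in sqball X Y m0 y) ||
   ((L X Y y x || L Y X y x) || (H X Y y x || H Y X y x)).
  move=> bx; case: (boolP (x \in sqball X Y m0 y)) => //=; rewrite inE negb_and -!ltNge => far.
  have aux (X' Y' : T -> R) : flat X' Y' y x -> 2 ^- m0 <= `|X' x - X' y| -> L X' Y' y x || H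
    X' Y' y x.
    by move=> fx fr; rewrite /L /H fx fr bx /=; exact: le_total.
  have [f|f|/andP[/eqP e1 /eqP e2]] := or3P (flat_or X Y y x).
  - have fr : 2 ^- m0 <= `|X x - X y|.
      by case/orP: far => [/ltW //|h]; move/andP: f => [_ /(lt_le_trans h) /ltW].
    by case/orP: (aux _ _ f fr) => ->; rewrite ?orbT.
  - have fr : 2 ^- m0 <= `|Y x - Y y|.
      by case/orP: far => [h|/ltW //]; move/andP: f => [_ /(lt_le_trans h) /ltW].
    by case/orP: (aux _ _ f fr) => ->; rewrite ?orbT.
  - by move: far; rewrite e1 e2 !subrr normr0 orbb ltNge invr_ge0 (ltW (p0 _)).
have bnd y : \sum_(x | bad l (q + p) y x) (1 : R) <=
   (9 * 2 `^ (- (s' * m0%:R)) + 336 * 2 ^+ m0 * K * (q + p).+1%:R * 2 `^ (- (al * (q + p)%:R)))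
     * #|T|%:R +
   (\sum_(x | H X Y y x) 1 + \sum_(x | H Y X y x) 1).
  apply: (le_trans (sum_split_or R (cls y))).
  apply: (le_trans (lerD (lexx _) (sum_split_or R (fun x h => h)))).
  rewrite addrA; apply: lerD; last exact: sum_split_or.
  apply: (le_trans (lerD (lexx _) (sum_split_or R (fun x h => h)))).
  have l1 := @light_sum_le l (q + p) m0 y X Y (or_introl (conj erefl erefl)) ql lN.
  have l2 := @light_sum_le l (q + p) m0 y Y X (or_intror (conj erefl erefl)) ql lN.
  have f1 := frost y mN; rewrite -sum1_card natr_sum in f1.
  by move: l1 l2 f1; rewrite -/(L X Y y) -/(L Y X y) => l1 l2 f1; lra.
apply: (le_trans (ler_sum _ (fun y _ => bnd y))).
rewrite big_split /= big_split /= sumr_const -[_ *+ #|_|]mulr_natr mulrDr.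
apply: lerD; first by rewrite expr2 mulrA.
by apply: lerD; apply: heavy.
Qed.

End BadPairs.

(** * Choice of the parameters *)

Section Constants.
Variable R : realType.
Implicit Types x a C : R.

Lemma ex_nat_ge x : exists n : nat, x <= n%:R.
Proof. by exists (Num.bound `|x|); rewrite (le_trans (ler_norm _)) // ltW // archi_boundP. Qed.

Lemma ln2_gt0 : 0 < ln 2 :> R.
Proof. by rewrite ln_gt0 // ltr1n. Qed.

(** This is the square of e^u >= u at u = x ln 2 / 2. Quadratic growth suffices to absorb the linear
    factor [q.+1] in the choice of scales. *)
Lemma powR2_sqr_ge x : 0 <= x -> (x * ln 2 / 2) ^+ 2 <= 2 `^ x :> R.
Proof.
move=> x0; have -> : 2 `^ x = expR (x * ln 2 / 2) ^+ 2.
  by rewrite /powR pnatr_eq0 /= expr2 -expRD; congr expR; lra.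
have h0 : 0 <= x * ln 2 / 2 by rewrite !mulr_ge0 ?invr_ge0 ?(ltW ln2_gt0).
rewrite ler_sqr ?nnegrE ?expR_ge0 //; apply: le_trans (expR_ge1Dx _); lra.
Qed.

Lemma ex_scale_decay a C : 0 < a -> 0 <= C ->
  exists q0 : nat, (0 < q0)%N /\ forall q : nat, (q0 <= q)%N -> C * q.+1%:R * 2 `^ (- (a *
    q%:R)) <= 1.
Proof.
move=> a0 C0; pose c := (a * ln 2 / 2) ^+ 2.
have c0 : 0 < c by rewrite exprn_gt0 // !mulr_gt0 ?invr_gt0 ?ln2_gt0.
have [n hn] := ex_nat_ge (2 * C / c).
exists n.+1; split=> // q nq; have q0 : 0 < q%:R :> R by rewrite ltr0n; lia.
have q1 : 1 <= q%:R :> R by rewrite ler1n; lia.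
rewrite powRN ler_pdivrMr ?powR_gt0 // mul1r.
apply: le_trans (powR2_sqr_ge _); last by rewrite mulr_ge0 // ltW.
have -> : (a * q%:R * ln 2 / 2) ^+ 2 = c * q%:R * q%:R by rewrite /c; ring.
have qn : n%:R <= q%:R :> R by rewrite ler_nat; lia.
have h : 2 * C <= c * q%:R.
  by have := le_trans hn qn; rewrite ler_pdivrMr // [q%:R * c]mulrC.
apply: (@le_trans _ _ (2 * C * q%:R)); last by rewrite ler_pM2r.
rewrite -natr1 mulrDr mulr1; have := ler_wpM2l C0 q1; lra.
Qed.

Lemma ex_small_step (F : nat -> R) (J : nat) c :
  (0 < J)%N -> F J - F 0 <= J%:R * c -> exists2 i, (i < J)%N & F i.+1 - F i <= c.
Proof.
move=> J0 H; case: (boolP [exists i : 'I_J, F i.+1 - F i <= c]) => [/existsP[i hi]|].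
  by exists i.
move=> /existsPn none; have {}none i : (i < J)%N -> c < F i.+1 - F i.
  by move=> iJ; have := none (Ordinal iJ); rewrite -ltNge.
suff : forall m, (0 < m <= J)%N -> m%:R * c < F m - F 0 by move/(_ J);
  rewrite J0 leqnn ltNge H => /(_ isT).
elim=> // -[|m] IH mJ.
  by rewrite mul1r; apply: none; lia.
have := IH _; have := none m.+1 _; rewrite -[m.+2%:R]natr1 mulrDl mul1r.
move=> /(_ (ltac:(lia))) h1 /(_ (ltac:(lia))) h2; lra.
Qed.

End Constants.

(** The upper bounds extracted from regularity. They pass to subsets and to rescaled dyadic squares,
    whereas lower bounds on the mass do not. *)
Record planar_cover (R : realType) (T : finType) (X Y : T -> R) (K s : R) (N : nat) : Prop := {
  pc_X : forall z, 0 <= X z < 1;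
  pc_Y : forall z, 0 <= Y z < 1;
  pc_cover : forall l p y, (l + p <= N)%N ->
    (nimg (sqball X Y l y) (cell X Y (l + p)))%:R <= K * 2 `^ (s * p%:R);
  pc_leaf : forall y, #|[set z | cell X Y N z == cell X Y N y]|%:R <= K }.

(** * Entropy budget against few distances *)

Section Contradiction.
Variables (R : realType) (T : finType) (X Y : T -> R) (K s t : R) (N : nat).
Hypothesis K1 : 1 <= K.
Hypothesis s1 : 1 < s.
Hypothesis pc : planar_cover X Y K s N.

(** Bad pairs are charged the trivial covering bound, all other pairs the threshold. *)
Lemma sum_ln_nloc_le (l q : nat) (al eta : R) : (l + q <= N)%N -> 0 <= al -> 
  \sum_y \sum_(x | bad X Y s al l q y x) (1 : R) <= eta * #|T|%:R ^+ 2 ->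
  \sum_x \sum_y ln (nloc X Y l q x y)%:R <=
   #|T|%:R ^+ 2 * ((s - 1 + 2 * al) * q%:R * ln 2 + eta * (ln K + s * q%:R * ln 2)).
Proof.
move=> lN al0 Hb; have l2 := ln2_gt0 R; have s1' : 1 < s := s1.
have K0 : 0 < K := lt_le_trans ltr01 K1.
have [A Ae] : exists A, A = (s - 1 + 2 * al) * q%:R * ln 2 by eexists.
have [B Be] : exists B, B = ln K + s * q%:R * ln 2 by eexists.
have B0 : 0 <= B.
  by rewrite Be addr_ge0 ?ln_ge0 // !mulr_ge0 ?(ltW l2) //; lra.
have A0 : 0 <= A by rewrite Ae !mulr_ge0 ?(ltW l2) //; lra.
have pt x y : ln (nloc X Y l q x y)%:R <= A + (if bad X Y s al l q y x then 1 else 0) * B.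
  have n0 : 0 < (nloc X Y l q x y)%:R :> R by rewrite ltr0n nloc_gt0.
  case: ifPn => [_|]; last first.
    rewrite /bad -ltNge mul0r addr0 => /ltW.
    by rewrite Ae -ln_powR ler_ln ?posrE ?powR_gt0.
  rewrite mul1r; apply: (@le_trans _ _ B); last by rewrite lerDr.
  rewrite Be -ln_powR -lnM ?posrE ?powR_gt0 //.
  by rewrite ler_ln ?posrE ?mulr_gt0 ?powR_gt0 // (nloc_le (pc_cover pc)).
apply: (le_trans (ler_sum _ (fun x _ => ler_sum _ (fun y _ => pt x y)))).
rewrite exchange_big /=.
under eq_bigr => y _ do rewrite big_split /= -mulr_suml -big_mkcond sumr_const.
rewrite big_split /= -mulr_suml sumr_const -[A *+ _]mulr_natr -Ae -Be -[_ *+ #|_|]mulr_natr.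
have := ler_wpM2r B0 Hb; lra.
Qed.

(** Budget in units of N ln 2: the distances give t = 1 - 4 al and the strips s - 1 + 2 al, together
    s - 2 al. Bad pairs add at most al / 2, the constants of the blocks al / 4, and the scales
    outside the blocks less than al / 4. The total is below s - al, while [T] has entropy at least s
    - al / 2. *)
Lemma entropy_contradiction (q : nat) (al eta : R) :
  0 < al -> t = 1 - 4 * al -> 0 <= eta -> 6 * eta * s <= al -> 3 * eta <= 1 ->
  (0 < q)%N -> (2 * q <= N)%N ->
  4 * (ln 5 + ln K) <= al * ln 2 * q%:R ->
  4 * (3 * ln K + 2 * (s * q%:R * ln 2)) < al * ln 2 * N%:R ->
  (forall l, (q <= l)%N -> (l + q <= N)%N ->
     \sum_y \sum_(x | bad X Y s al l q y x) (1 : R) <= 3 * eta * #|T|%:R ^+ 2) ->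
  (forall x, (nimg [set: T] (fun z => dyfloor N (dst X Y x z)))%:R <= 2 `^ (t * N%:R)) ->
  2 `^ ((s - al / 2) * N%:R) <= #|T|%:R -> False.
Proof.
move=> al0 et eta0 h1 h2 q0 qN hq hN Hbad Hd HT; have l2 := ln2_gt0 R; have s1' : 1 < s := s1.
have lnK0 : 0 <= ln K by rewrite ln_ge0.
have n0 : 0 < #|T|%:R :> R by apply: lt_le_trans HT; apply: powR_gt0.
set n := #|T|%:R in n0 HT Hbad.
(* The blocks begin at the scales q, 2 q, ..., M q; the first q scales and the remainder of N modulo
   q are left out. *)
pose M := (N %/ q).-1.
have Nq : (2 <= N %/ q)%N by rewrite leq_divRL.
have MS : M.+1 = (N %/ q)%N by exact: ltn_predK Nq.
have M1 : (M.+1 * q <= N)%N by rewrite MS leq_divM.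
have M2 : (N <= M.+1 * q + q)%N.
  by rewrite MS -mulSnr ltnW // ltn_ceil.
pose P := 3 * ln K + 2 * (s * q%:R * ln 2) + t * N%:R * ln 2 + M%:R * ln 5.
pose S j x := \sum_y ln (nloc X Y (j.+1 * q) q x y)%:R : R.
have E x : n * ln n <= n * P + \sum_(j < M) S j x.
  apply: (le_trans (entropy_at K1 (ltW (lt_trans ltr01 s1)) (pc_X pc) (pc_Y pc) (pc_cover pc)
    (pc_leaf pc) x M1 M2)).
  rewrite lerD2r ler_pM2l // /P.
  rewrite lerD2r lerD2l -ln_powR ler_ln ?posrE ?powR_gt0 //.
  by rewrite ltr0n (@nimg_gt0 _ _ _ _ x) ?inE.
have E2 : n ^+ 2 * ln n <= n ^+ 2 * P + \sum_(j < M) \sum_x S j x.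
  have : \sum_(x : T) n * ln n <= \sum_x (n * P + \sum_(j < M) S j x) by apply: ler_sum.
  rewrite big_split /= !sumr_const exchange_big /= -[n * _ *+ _]mulr_natr -[_ * P *+
    _]mulr_natr -/n; lra.
have E3 : \sum_(j < M) \sum_x S j x <= M%:R * (n ^+ 2 * ((s - 1 + 2 * al) * q%:R * ln 2 + 3 *
  eta * (ln K + s * q%:R * ln 2))).
  rewrite mulr_natl -[X in _ <= _ *+ X]card_ord -sumr_const; apply: ler_sum => j _.
  have jl : (j.+1 * q + q <= N)%N.
    by apply: leq_trans M1; rewrite -mulSnr leq_mul2r ltnS ltn_ord orbT.
  apply: sum_ln_nloc_le => //; first exact: ltW.
  by apply: Hbad => //; rewrite leq_pmull.
have {E2 E3} E : ln n <= P + M%:R * ((s - 1 + 2 * al) * q%:R * ln 2 + 3 * eta * (ln K + s *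
  q%:R * ln 2)).
  have n20 : 0 < n ^+ 2 by rewrite exprn_gt0.
  rewrite -(ler_pM2l n20) mulrDr; apply: (le_trans E2); rewrite lerD2l; apply: (le_trans E3).
  by rewrite mulrCA.
have HT' : (s - al / 2) * N%:R * ln 2 <= ln n by rewrite -ln_powR ler_ln ?posrE ?powR_gt0.
have MqN : M%:R * q%:R <= N%:R :> R by rewrite -natrM ler_nat (leq_trans _ M1) // leq_mul2r
  leqnSn orbT.
have {}MqN : M%:R * (q%:R * ln 2) <= N%:R * ln 2 :> R by rewrite mulrA ler_pM2r.
set Z := N%:R * ln 2 in MqN.
have Z0 : 0 <= Z by rewrite mulr_ge0 // ltW.
have a1 : M%:R * ((s - 1 + 2 * al) * q%:R * ln 2) <= (s - 1 + 2 * al) * Z.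
  have c : 0 <= s - 1 + 2 * al by lra.
  by have := ler_wpM2l c MqN; lra.
have a2 : M%:R * (3 * eta * (s * q%:R * ln 2)) <= al / 2 * Z.
  have c : 0 <= al / 2 by lra.
  apply: le_trans (ler_wpM2l c MqN).
  have c2 : 0 <= M%:R * (q%:R * ln 2) :> R by rewrite !mulr_ge0 // ltW.
  have c3 : 3 * eta * s <= al / 2 by lra.
  by have := ler_wpM2r c2 c3; lra.
have a3 : M%:R * (3 * eta * ln K) <= M%:R * ln K.
  by rewrite ler_wpM2l // ler_piMl.
have a4 : 4 * (M%:R * ln 5 + M%:R * ln K) <= al * Z.
  have := ler_wpM2l (ler0n R M) hq.
  have := ler_wpM2l (ltW al0) MqN; lra.
have hT2 : (s - al / 2) * Z <= ln n by rewrite /Z mulrA.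
have hN2 : 4 * (3 * ln K + 2 * (s * q%:R * ln 2)) < al * Z by rewrite /Z [N%:R * _]mulrC [X in
  _ < X]mulrA.
have tP : t * N%:R * ln 2 = (1 - 4 * al) * Z by rewrite et /Z; ring.
have aZ := mulr_ge0 (ltW al0) Z0.
move: E; rewrite /P tP; lra.
Qed.

End Contradiction.

(** * Pigeonholing the block length under a Frostman condition *)

Lemma pair_energy_ge0 (R : realType) (T : finType) (X Y : T -> R) (Q q : nat) :
  0 <= pair_energy X Y Q q.
Proof.
rewrite mulr_ge0 ?exprn_ge0 //; apply: sumr_ge0 => k _; apply: sumr_ge0 => z _.
exact: ler0n.
Qed.

(** The constant 9 bounds the number of dyadic squares of side 2^-i met by a sup norm ball of radius
    2^-i. *)
Definition frostman (R : realType) (T : finType) (X Y : T -> R) (s' : R) (N : nat) : Prop :=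
  forall i y, (i <= N)%N -> #|sqball X Y i y|%:R <= 9 * 2 `^ (- (s' * i%:R)) * #|T|%:R.

(** The order of choice is [al], [eta], the distance 2^-m0 below which pairs count as close, then a
    finite ladder [qs] of block lengths, and last the bound on N. The energy, monotone in spirit and
    bounded since s' > 1, has a small increment on some rung, whose upper end becomes q. *)
Lemma frostman_case (R : realType) (s s' K t : R) :
  1 < s -> 1 < s' -> 1 <= K -> t < 1 ->
  exists (eps : R) (N0 : nat), 0 < eps /\
    forall (N : nat) (T : finType) (X Y : T -> R), (N0 <= N)%N ->
      planar_cover X Y K s N -> frostman X Y s' N ->
      (forall x, (nimg [set: T] (fun z => dyfloor N (dst X Y x z)))%:R <= 2 `^ (t * N%:R)) ->
      2 `^ ((s - eps) * N%:R) <= #|T|%:R -> False.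
Proof.
move=> s1 s'1 K1 t1; have l2 := ln2_gt0 R; have lnK0 : 0 <= ln K by rewrite ln_ge0.
pose al := (1 - t) / 4; have al0 : 0 < al by rewrite /al; lra.
have al2 : 0 < al * ln 2 by exact: mulr_gt0.
pose eta := Num.min (al / (6 * s)) (1 / 3); have s0 : 0 < s by lra.
have eta0 : 0 < eta.
  by rewrite /eta lt_min; apply/andP; split; [apply: divr_gt0 => //; lra | lra].
have eta1 : 6 * eta * s <= al.
  have : eta <= al / (6 * s) by rewrite ge_min lexx.
  by rewrite ler_pdivlMr ?mulr_gt0 //; lra.
have eta2 : 3 * eta <= 1.
  have : eta <= 1 / 3 by rewrite ge_min lexx orbT.
  lra.
have [m0 hm0] := ex_nat_ge (9 / eta).
have m0s : 9 * 2 `^ (- (s' * m0%:R)) <= eta.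
  rewrite powRN ler_pdivrMr ?powR_gt0 //.
  move: hm0; rewrite ler_pdivrMr // mulrC => h; apply: (le_trans h).
  rewrite ler_pM2l //; apply: (@le_trans _ _ (2 ^ m0)%:R);
    first by rewrite ler_nat ltnW // ltn_expl.
  rewrite natrX -powR_mulrn // ler_powR ?ler1n // -[leLHS]mul1r ler_wpM2r // ltW //.
pose C := 336 * 2 ^+ m0 * K / eta.
have C0 : 0 <= C := divr_ge0 (mulr_ge0 (mulr_ge0 (ler0n R 336) (exprn_ge0 m0 (ler0n R 2)))
  (le_trans ler01 K1)) (ltW eta0).
have [qa [qa0 hqa]] := ex_scale_decay al0 C0.
have [qb hqb] := ex_nat_ge (4 * (ln 5 + ln K) / (al * ln 2)).
have [e he] := ex_nat_ge al^-1.
have e0 : (0 < e)%N.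
  by rewrite -(ltr_nat R); apply: lt_le_trans he; rewrite invr_gt0.
pose G := 24 / (1 - 2 `^ (1 - s')) * 9.
(* The factor 72 is 36, from the heavy cones, times 2, for the two orders of coordinates. *)
have [J' hJ] := ex_nat_ge (72 * G / eta).
pose J := J'.+1.
(* As e >= 1 / al, each rung satisfies al * qs (i + 1) >= qs i + 4; hence 12 * 2^(qs i) <= 16 *
   2^(qs i) <= 2^(al * qs (i + 1)). *)
have [qs [qs0 qsE]] : exists qs : nat -> nat,
    qs 0%N = maxn qa qb /\ forall i, qs i.+1 = (e * (qs i + 4))%N.
  by exists (fun i => iter i (fun q => e * (q + 4))%N (maxn qa qb)).
have qsS i : (qs i + 4 <= qs i.+1)%N by rewrite qsE leq_pmull.
have qs_mono i j : (i <= j)%N -> (qs i <= qs j)%N.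
  elim: j => [|j IH]; first by rewrite leqn0 => /eqP ->.
  rewrite leq_eqVlt => /orP[/eqP -> //|ij].
  by apply: leq_trans (IH ij) _; apply: leq_trans (qsS j); apply: leq_addr.
pose Q := qs J.
(* The largest rung [Q] is used, so that the bound on N serves whichever rung is selected later. *)
have [Nb hNb] := ex_nat_ge (4 * (3 * ln K + 2 * (s * Q%:R * ln 2)) / (al * ln 2)).
exists (al / 2), (maxn (2 * Q) (maxn m0 Nb.+1)); split; first by rewrite divr_gt0.
move=> N T X Y; rewrite !geq_max => /and3P[NQ Nm Nb1] pc fr Hd HT.
have n0 : 0 < #|T|%:R :> R by apply: lt_le_trans HT; apply: powR_gt0.
set n := #|T|%:R in n0.
have NQ' : (Q <= N)%N by apply: leq_trans NQ; rewrite leq_pmull.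
pose F i : R := (pair_energy X Y Q (qs i) + pair_energy Y X Q (qs i)) / (2 ^+ Q).
have p0 k : 0 < 2 ^+ k :> R by rewrite exprn_gt0.
have en X' Y' : (forall z, 0 <= X' z < 1) -> (forall z, 0 <= Y' z < 1) -> 
    (forall i y, sqball X' Y' i y = sqball X Y i y) -> pair_energy X' Y' Q Q <= G * n ^+ 2 * 2
      ^+ Q.
  move=> X'01 Y'01 nn.
  have D0 : 0 <= 9 * n by rewrite mulr_ge0 // ltW.
  have H : forall i y, (i <= Q)%N -> #|sqball X' Y' i y|%:R <= 9 * n * 2 `^ (- (s' * i%:R)).
    by move=> i y iQ; rewrite nn mulrAC; apply: fr; exact: leq_trans NQ'.
  apply: (le_trans (pair_energy_le (leqnn Q) X'01 Y'01 D0 s'1 H)).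
  by rewrite -/n /G le_eqVlt; apply/orP; left; apply/eqP; ring.
have FJ : F J - F 0%N <= J%:R * (eta / 36 * n ^+ 2).
  have F0 : 0 <= F 0%N by rewrite divr_ge0 ?addr_ge0 ?pair_energy_ge0 // ltW.
  have FJ : F J <= 2 * G * n ^+ 2.
    rewrite /F ler_pdivrMr // -/Q.
    have h1 := en X Y (pc_X pc) (pc_Y pc) (fun _ _ => erefl).
    have h2 := en Y X (pc_Y pc) (pc_X pc) (fun _ _ => sqballC _ _ _ _).
    by apply: (le_trans (lerD h1 h2)); lra.
  have JG : 72 * G <= J%:R * eta.
    by move: hJ; rewrite ler_pdivrMr // => h; apply: (le_trans h); rewrite ler_pM2r // ler_nat /J.
  have n20 : 0 <= n ^+ 2 by rewrite exprn_ge0 // ltW.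
  have := ler_wpM2r n20 JG; lra.
have [i iJ step] := ex_small_step (ltn0Sn _) FJ.
pose q := qs i.+1.
have q0 : (0 < q)%N by apply: leq_trans (qsS i); rewrite addn4.
have qaq : (maxn qa qb <= q)%N by rewrite -qs0; apply: qs_mono.
have qQ : (q <= Q)%N by apply: qs_mono.
have alq : 12 * 2 ^+ qs i <= 2 `^ (al * q%:R).
  apply: (@le_trans _ _ (2 ^+ (qs i + 4))).
    by rewrite exprD; have := p0 (qs i); lra.
  rewrite -powR_mulrn // ler_powR ?ler1n // /q qsE natrM mulrA.
  rewrite -[leLHS]mul1r ler_wpM2r //.
  by move: (ler_wpM2l (ltW al0) he); rewrite mulfV // gt_eqF.
apply: (@entropy_contradiction _ _ _ _ K s t N K1 s1 pc q al eta) => //.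
- by rewrite /al; field.
- exact: ltW.
- by apply: leq_trans NQ; rewrite leq_mul2l qQ.
- move: hqb; rewrite ler_pdivrMr // [_ * (al * _)]mulrC => h; apply: (le_trans h).
  by rewrite ler_pM2l // ler_nat (leq_trans _ qaq) // leq_maxr.
- move: hNb; rewrite ler_pdivrMr // [_ * (al * _)]mulrC => h.
  apply: (@le_lt_trans _ _ (al * ln 2 * Nb%:R)); last by rewrite ltr_pM2l // ltr_nat.
  apply: le_trans h; rewrite ler_pM2l // lerD2l ler_pM2l // ler_pM2r // ler_pM2l // ler_nat //.
- move=> l ql lN.
  have qe : (qs i + (q - qs i) = q)%N by rewrite subnKC //; apply: qs_mono.
  have H := @bad_pairs_le R T X Y K s s' al N (ltW s1) (pc_X pc) (pc_Y pc) (pc_cover pc) fr l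
    (qs i) (q - qs i)%N Q m0.
  move: H; rewrite qe => /(_ ql lN qQ Nm alq) H; apply: (le_trans H).
  have E1 : 336 * 2 ^+ m0 * K * q.+1%:R * 2 `^ (- (al * q%:R)) <= eta.
    have := hqa q _; rewrite /C; have -> : (qa <= q)%N by apply: leq_trans qaq; apply: leq_maxl.
    move=> /(_ isT) h.
    have := ler_wpM2l (ltW eta0) h; rewrite mulr1; apply: le_trans.
    rewrite le_eqVlt; apply/orP; left; apply/eqP; field; rewrite gt_eqF //.
  have E2 : 36 / 2 ^+ Q * (pair_energy X Y Q q - pair_energy X Y Q (qs i) +
     (pair_energy Y X Q q - pair_energy Y X Q (qs i))) <= eta * n ^+ 2.
    rewrite (_ : 36 / 2 ^+ Q * _ = 36 * (F i.+1 - F i)); last first.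
      by rewrite /F -/q; field; rewrite gt_eqF.
    by have := step; lra.
  have n20 : 0 <= n ^+ 2 by rewrite exprn_ge0 // ltW.
  have := ler_wpM2r n20 (lerD m0s E1); rewrite -/n; lra.
Qed.

(** * Zooming into a dense square *)

Lemma dyfloor_rescale (R : realType) (i l : nat) (u : R) (c : int) :
  dyfloor l (2 ^+ i * u - c%:~R) = dyfloor (i + l) u - 2 ^+ l * c.
Proof.
have /andP[h1 h2] := dyfloor_bounds (i + l) u.
apply: dyfloor_itv; rewrite rmorphB rmorphM rmorphXn /=.
have -> : 2 ^+ l * (2 ^+ i * u - c%:~R) = 2 ^+ (i + l) * u - 2 ^+ l * c%:~R :> R.
  by rewrite exprD; ring.
by rewrite lerD2r h1 /= addrAC ltrD2r.
Qed.

Lemma nimg_sqball_cell (R : realType) (T : finType) (X Y : T -> R) (l : nat) (y : T) :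
  (nimg (sqball X Y l y) (cell X Y l) <= 9)%N.
Proof.
apply: leq_trans (nimg_pair _ _ _) _.
have three (f : T -> R) : {in sqball X Y l y, forall z, `|f z - f y| <= 2 ^- l} ->
    (nimg (sqball X Y l y) (fun z => dyfloor l (f z)) <= 3)%N.
  move=> H; apply: (@nimg_int _ _ _ (dyfloor l (f y) - 1)) => z /H h.
  have := @dist_dyfloor R l 1 (f z) (f y); rewrite mul1r => /(_ h) /=; lia.
rewrite -[9%N]/(3 * 3)%N leq_mul // three // => z; rewrite inE => /andP[] //.
Qed.

Section Zoom.
Variables (R : realType) (T : finType) (X Y : T -> R) (K s : R) (N i : nat) (z0 : T).
Hypothesis pc : planar_cover X Y K s N.
Hypothesis iN : (i <= N)%N.

Definition zoomT : finType := {z : T | cell X Y i z == cell X Y i z0}.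
(** The affine change of coordinate that carries the dyadic interval of level i around [f z0] onto
    [0, 1). *)
Definition zoom (f : T -> R) (z : zoomT) : R := 2 ^+ i * f (val z) - (dyfloor i (f z0))%:~R.

Let X0 := zoom X.
Let Y0 := zoom Y.

Lemma card_zoom : #|zoomT| = #|[set z | cell X Y i z == cell X Y i z0]|.
Proof. by rewrite card_sig cardsE. Qed.

Lemma zoom_cell l z w : (cell X0 Y0 l z = cell X0 Y0 l w) <->
  (cell X Y (i + l) (val z) = cell X Y (i + l) (val w)).
Proof.
by rewrite /cell /X0 /Y0 /zoom !dyfloor_rescale; split=> -[e1 e2]; congr pair;
   [exact: (addIr _ e1)|exact: (addIr _ e2)|rewrite e1|rewrite e2].
Qed.

Lemma zoom_sqball l y z : (z \in sqball X0 Y0 l y) = (val z \in sqball X Y (i + l) (val y)).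
Proof.
have p0 k : 0 < 2 ^+ k :> R by rewrite exprn_gt0.
have aux (f : T -> R) : (`|zoom f z - zoom f y| <= 2 ^- l) = (`|f (val z) - f (val y)| <= 2 ^-
  (i + l)).
  have -> : zoom f z - zoom f y = 2 ^+ i * (f (val z) - f (val y)) by rewrite /zoom; ring.
  have -> : 2 ^- l = 2 ^+ i * 2 ^- (i + l) :> R.
    by rewrite exprD invfM mulrA mulfV ?mul1r // gt_eqF.
  by rewrite normrM gtr0_norm // ler_pM2l.
by rewrite !inE !aux.
Qed.

Lemma zoom_dst x z : dst X0 Y0 x z = 2 ^+ i * dst X Y (val x) (val z).
Proof.
rewrite /dst -[in RHS](ger0_norm (exprn_ge0 i (ler0n R 2))) -[in RHS]sqrtr_sqr.
by rewrite -sqrtrM ?sqr_ge0 //; congr Num.sqrt; rewrite /X0 /Y0 /zoom; ring.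
Qed.

Lemma zoom_cover : planar_cover X0 Y0 K s (N - i).
Proof.
have range (f : T -> R) : (forall z : zoomT, dyfloor i (f (val z)) = dyfloor i (f z0)) ->
    forall z, 0 <= zoom f z < 1.
  move=> H z; have := dyfloor_bounds i (f (val z)); rewrite H /zoom => /andP[h1 h2].
  by apply/andP; split; lra.
split.
- by apply: range => z; case: (eqP (valP z)).
- by apply: range => z; case: (eqP (valP z)).
- move=> l p y lp; have := pc_cover pc (l := i + l) (p := p) (val y).
  move=> H; apply: le_trans (H _); last by rewrite -addnA -leq_subRL || lia.
  rewrite ler_nat; apply: (nimg_transport (f := val)) => [z|z w _ _].
    by rewrite zoom_sqball.
  by rewrite -addnA => /zoom_cell.
- move=> y; apply: le_trans (pc_leaf pc (val y)); rewrite ler_nat.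
  rewrite -(card_imset _ val_inj) subset_leq_card //.
  apply/fintype.subsetP => _ /imsetP[z + ->]; rewrite !inE => /eqP /zoom_cell.
  by rewrite subnKC // => ->.
Qed.

(** By maximality a square j levels deeper holds at most 2^(- s' j) of the points of the chosen one,
    and nine squares cover a ball. *)
Lemma zoom_frostman (s' : R) :
  (forall j z, (j <= N)%N ->
     #|[set w | cell X Y j w == cell X Y j z]|%:R * 2 `^ (s' * j%:R) <=
     #|[set w | cell X Y i w == cell X Y i z0]|%:R * 2 `^ (s' * i%:R)) ->
  frostman X0 Y0 s' (N - i).
Proof.
move=> Hmax j y jN; have iN' := iN.
have -> : 9 * 2 `^ (- (s' * j%:R)) * #|zoomT|%:R = 9 * (2 `^ (- (s' * j%:R)) * #|zoomT|%:R) :>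
  R by rewrite mulrA.
apply: (@le_trans _ _ #|sqball X Y (i + j) (val y)|%:R).
  rewrite ler_nat -(card_imset _ val_inj) subset_leq_card //.
  by apply/fintype.subsetP => _ /imsetP[z + ->]; rewrite zoom_sqball.
apply: le_trans (card_le_nimg (g := cell X Y (i + j)) (m := 2 `^ (- (s' * j%:R)) * #|zoomT|%:R)
  _) _; last first.
  by rewrite ler_wpM2r ?mulr_ge0 ?powR_ge0 // -[9]/(9%:R) ler_nat nimg_sqball_cell.
move=> z _; have := Hmax (i + j)%N z; rewrite -card_zoom => /(_ _) H.
apply: (@le_trans _ _ #|[set w | cell X Y (i + j) w == cell X Y (i + j) z]|%:R).
  by rewrite ler_nat subset_leq_card //; apply/fintype.subsetP => w; rewrite !inE => /andP[].
have q0 : 0 < 2 `^ (s' * (i + j)%:R) :> R by rewrite powR_gt0.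
rewrite -(ler_pM2r q0); apply: le_trans (H _) _; first by lia.
rewrite [leRHS]mulrAC -powRD ?pnatr_eq0 ?implybT // [leLHS]mulrC ler_wpM2r //.
by rewrite le_eqVlt; apply/orP; left; apply/eqP; congr (_ `^ _); rewrite natrD; ring.
Qed.

End Zoom.

(** The chosen square cannot be too small: its mass times 2^(s' i) is at least |T|, nearly 2^(sN),
    while covering bounds its mass by K^2 2^(s(N-i)). As s' < s, the level i is a small fraction of
    N. *)
Lemma planar_case (R : realType) (s K t : R) : 1 < s -> 1 <= K -> 0 < t -> t < 1 ->
  exists (eps : R) (N0 : nat), 0 < eps /\
    forall (N : nat) (T : finType) (X Y : T -> R), (N0 <= N)%N ->
      planar_cover X Y K s N ->
      (forall x, (nimg [set: T] (fun z => dyfloor N (dst X Y x z)))%:R <= 2 `^ (t * N%:R)) ->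
      2 `^ ((s - eps) * N%:R) <= #|T|%:R -> False.
Proof.
move=> s1 K1 t0 t1; have l2 := ln2_gt0 R; have lnK0 : 0 <= ln K by rewrite ln_ge0.
pose s' := (1 + s) / 2; have s'1 : 1 < s' by rewrite /s'; lra.
pose t' := (1 + t) / 2; have t'1 : t' < 1 by rewrite /t'; lra.
have [eps1 [N1 [eps10 H1]]] := frostman_case s1 s'1 K1 t'1.
(* With i <= th N, the distance bound 2^(tN) is at most 2^(t'(N-i)), because t' - th = t. *)
pose th := (1 - t) / 2; have th0 : 0 < th by rewrite /th; lra.
pose sg := s - s'; have sg0 : 0 < sg by rewrite /sg /s'; lra.
have st0 : 0 < sg * th by apply: mulr_gt0.
(* The first term serves the rescaled cardinality bound, as N - i >= N / 2; the second confines i to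
   at most th N. *)
pose eps := Num.min (eps1 / 2) (sg * th / 2).
have eps0 : 0 < eps by rewrite /eps lt_min; apply/andP; split; lra.
have epsa : eps <= eps1 / 2 by rewrite ge_min lexx.
have epsb : eps <= sg * th / 2 by rewrite ge_min lexx orbT.
have [Nb hNb] := ex_nat_ge (4 * ln K / (ln 2 * (sg * th))).
exists eps, (maxn (2 * N1) Nb); split=> // N T X Y; rewrite geq_max => /andP[hN1 hN2] pc Hd HT.
have n0 : 0 < #|T|%:R :> R by apply: lt_le_trans HT; apply: powR_gt0.
have [x0 _] : exists x : T, x \in T by apply/card_gt0P; rewrite -(ltr0n R).
pose c (p : 'I_N.+1 * T) : R :=
  #|[set w | cell X Y p.1 w == cell X Y p.1 p.2]|%:R * 2 `^ (s' * p.1%:R).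
have [[i z0] _ Hmax] := @arg_maxP _ R _ (ord0, x0) xpredT c isT.
have iN : (i <= N)%N by rewrite -ltnS.
have {}Hmax j z : (j <= N)%N ->
     #|[set w | cell X Y j w == cell X Y j z]|%:R * 2 `^ (s' * j%:R) <=
     #|[set w | cell X Y i w == cell X Y i z0]|%:R * 2 `^ (s' * i%:R).
  by move=> jN; have := Hmax (Ordinal (jN : (j < N.+1)%N), z) isT.
set n0' := #|[set w | cell X Y i w == cell X Y i z0]|%:R in Hmax.
have nT : #|T|%:R <= n0' * 2 `^ (s' * i%:R).
  apply: le_trans (Hmax 0%N x0 (leq0n _)); rewrite mulr0 powRr0 mulr1 ler_nat.
  rewrite -cardsT subset_leq_card //; apply/fintype.subsetP => w _; rewrite inE.
  have fl0 (u : R) : 0 <= u < 1 -> dyfloor 0 u = 0 by move=> h; apply: dyfloor_itv;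
    rewrite mul1r add0r.
  by rewrite /cell !fl0 ?(pc_X pc) ?(pc_Y pc).
have nC : n0' <= K * 2 `^ (s * (N - i)%:R) * K.
  by apply: (card_cell_le K1 (pc_cover pc) (pc_leaf pc)).
have Ni : (N - i)%:R = N%:R - i%:R :> R by rewrite natrB.
have K0 : 0 < K := lt_le_trans ltr01 K1.
have lnn : (s - eps) * N%:R * ln 2 <= 2 * ln K + s * (N%:R - i%:R) * ln 2 + s' * i%:R * ln 2.
  have := le_trans HT (le_trans nT (ler_wpM2r (powR_ge0 2 (s' * i%:R)) nC)).
  set A := 2 `^ _; set B := _ * _ => AB.
  have : ln A <= ln B by rewrite ler_ln ?posrE ?mulr_gt0 ?powR_gt0.
  rewrite /A /B !lnM ?posrE ?mulr_gt0 ?powR_gt0 // !ln_powR Ni; lra.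
have Nr0 : 0 <= N%:R :> R by [].
have isg : sg * i%:R <= sg * (th * N%:R).
  have h1 : 4 * ln K <= ln 2 * (sg * th) * N%:R.
    have l3 : 0 < ln 2 * (sg * th) by exact: mulr_gt0.
    move: hNb; rewrite ler_pdivrMr // => h; rewrite [leRHS]mulrC; apply: (le_trans h).
    by apply: ler_wpM2r; [exact: ltW | rewrite ler_nat].
  have h2 : eps * N%:R <= sg * th / 2 * N%:R by rewrite ler_wpM2r.
  have h3 := ler_wpM2r (ltW l2) h2.
  rewrite -(ler_pM2r l2); move: lnn h1 h3; rewrite /sg; lra.
have ith : i%:R <= th * N%:R by rewrite -(ler_pM2l sg0).
have i2 : i%:R <= N%:R / 2 :> R.
  by apply: (le_trans ith); rewrite mulrC ler_wpM2l // /th; lra.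
have N1' : (N1 <= N - i)%N.
  have : (2 * i <= N)%N by rewrite -(ler_nat R) natrM; lra.
  by move: hN1; clear; lia.
apply: (H1 (N - i)%N (zoomT X Y i z0) (zoom X) (zoom Y)) => //.
- exact: zoom_cover.
- exact: zoom_frostman.
- move=> x; apply: (@le_trans _ _ (2 `^ (t * N%:R))); last first.
    rewrite ler_powR ?ler1n // Ni; have : t' * i%:R <= i%:R by rewrite ler_piMl // ltW.
    by move: ith; rewrite /t' /th; lra.
  apply: le_trans (Hd (val x)); rewrite ler_nat.
  apply: (nimg_transport (f := val)) => // z w _ _ e.
  have := @dyfloor_rescale R i (N - i) (dst X Y (val x) (val z)) 0.
  have := @dyfloor_rescale R i (N - i) (dst X Y (val x) (val w)) 0.
  by rewrite !zoom_dst !subr0 !mulr0 !subr0 subnKC // => -> ->.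
- rewrite card_zoom -/n0' -(ler_pM2r (powR_gt0 (s' * i%:R) (ltr0n R 2))).
  apply: (le_trans _ nT); apply: (le_trans _ HT).
  rewrite -powRD ?pnatr_eq0 ?implybT // ler_powR ?ler1n // Ni.
  have h1 : eps * N%:R <= eps1 / 2 * N%:R by rewrite ler_wpM2r.
  have h2 := ler_wpM2l (ltW eps10) i2.
  have h3 : 0 <= sg * i%:R by rewrite mulr_ge0 // ltW.
  by move: h1 h2 h3; rewrite /sg; lra.
Qed.

(** * Regular sets *)

Local Open Scope classical_set_scope.
Local Open Scope ring_scope.

Lemma counting_ltyP (R : realType) (T : choiceType) (S : set T) :
  (counting S < +oo :> \bar R)%E ->
  exists u : seq T, [/\ uniq u, (forall x, S x <-> x \in u) &
    counting S = (size u)%:R%:E :> \bar R].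
Proof.
rewrite /counting; case: asboolP => // fS _; exists (enum_fset (fset_set S)); split => //.
by move=> x; rewrite in_fset_set // inE.
Qed.

Section Plane.
Variable R : realType.
Implicit Types x y : 'rV[R]_2.

Definition abscissa x : R := x 0 ord0.
Definition ordinate x : R := x 0 (lift ord0 ord0).

Lemma edistE x y : Defs.edist x y =
  Num.sqrt ((abscissa x - abscissa y) ^+ 2 + (ordinate x - ordinate y) ^+ 2).
Proof. by rewrite /Defs.edist !big_ord_recl big_ord0 addr0. Qed.

Lemma edist_le x y : Defs.edist x y <= `|abscissa x - abscissa y| + `|ordinate x - ordinate y|.
Proof.
rewrite edistE -[leRHS]ger0_norm ?addr_ge0 // -sqrtr_sqr ler_wsqrtr //.
rewrite -(real_normK (num_real (abscissa x - _))) -(real_normK (num_real (ordinate x - _))).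
have := mulr_ge0 (normr_ge0 (abscissa x - abscissa y)) (normr_ge0 (ordinate x - ordinate y)).
by rewrite sqrrD; lra.
Qed.

Lemma abscissa_le x y : `|abscissa x - abscissa y| <= Defs.edist x y.
Proof. by rewrite edistE -sqrtr_sqr ler_wsqrtr // lerDl sqr_ge0. Qed.

Lemma ordinate_le x y : `|ordinate x - ordinate y| <= Defs.edist x y.
Proof. by rewrite edistE -sqrtr_sqr ler_wsqrtr // lerDr sqr_ge0. Qed.

Variables (s C : R) (N : nat) (B : set 'rV[R]_2).
Hypothesis C1 : 1 < C.
Hypothesis s1 : 1 < s.
Hypothesis regB : discrete_ahlfors_regular s C N B.

Lemma regular_ball x k : B x -> (k < N)%N ->
  exists u : seq 'rV[R]_2, [/\ uniq u, (forall w, w \in u <-> Defs.edist x w <= 2 ^- k /\ B w),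
    C^-1 * 2 `^ ((N - k)%:R * s) <= (size u)%:R & (size u)%:R <= C * 2 `^ ((N - k)%:R * s)].
Proof.
move=> Bx kN; have [h1 h2] := regB Bx kN.
have [u [uu uP e]] := counting_ltyP (le_lt_trans h2 (ltry _)).
exists u; split=> //; last 2 first.
- by move: h1; rewrite e lee_fin.
- by move: h2; rewrite e lee_fin.
- by move=> w; rewrite -uP.
Qed.

Variables (T : finType) (pt : T -> 'rV[R]_2).
Hypothesis BT : forall z, B (pt z).
Hypothesis pt_unit : forall z, 0 <= abscissa (pt z) <= 1 /\ 0 <= ordinate (pt z) <= 1.
Hypothesis pt_inj : injective pt.

(* Halving the coordinates moves the closed unit square into [0, 1)^2. *)
Let X z : R := abscissa (pt z) / 2.
Let Y z : R := ordinate (pt z) / 2.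

Lemma half_dist (a b : R) (k : nat) : (`|a / 2 - b / 2| <= 2 ^- k.+1) = (`|a - b| <= 2 ^- k).
Proof.
rewrite -mulrBl normrM [ `|2^-1|]gtr0_norm ?invr_gt0 // exprS invfM mulrC ler_pM2l ?invr_gt0 //.
Qed.

(** Each occupied square has a representative whose ball of radius 2^-k contains at least C^-1
    2^((N-k)s) points of [B]. These balls lie in the ball of radius 2^-l around [y], with at most C
    2^((N-l)s) points, and a point is in at most nine of them. Three levels of margin ensure the
    inclusion; squares have level k + 1 because coordinates are halved. *)
Lemma nimg_ball_le (S : {set T}) (y : T) (l k : nat) :
  (l + 3 <= k)%N -> (k < N)%N ->
  {in S, forall z, `|abscissa (pt z) - abscissa (pt y)| <= 2 ^- (l + 3) /\
                   `|ordinate (pt z) - ordinate (pt y)| <= 2 ^- (l + 3)} ->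
  (nimg S (cell X Y k.+1))%:R <= 9 * C ^+ 2 * 2 `^ (s * (k - l)%:R).
Proof.
move=> lk kN sqball; have p0 n : 0 < 2 ^+ n :> R by rewrite exprn_gt0.
have C0 : 0 < C by apply: lt_trans C1.
set u := undup [seq cell X Y k.+1 z | z <- enum S].
have uu : uniq u by apply: undup_uniq.
have [G [uG GP _ cG]] := regular_ball (BT y) (leq_ltn_trans (leq_trans (leq_addr 3 l) lk) kN).
pose rep c := odflt y [pick z | (z \in S) && (cell X Y k.+1 z == c)].
have repP c : c \in u -> rep c \in S /\ cell X Y k.+1 (rep c) = c.
  move/mem_img => [z zS e]; rewrite /rep; case: pickP => [w /andP[wS /eqP //]|/(_ z)].
  by rewrite zS e eqxx.
pose hit c w := Defs.edist (pt (rep c)) w <= 2 ^- k.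
have low c : c \in u -> C^-1 * 2 `^ ((N - k)%:R * s) <= \sum_(w <- G) (hit c w)%:R.
  move=> /repP[rS _]; have [H [uH HP cH _]] := regular_ball (BT (rep c)) kN.
  apply: (le_trans cH); rewrite -natr_sum ler_nat.
  have -> : (\sum_(w <- G) hit c w = size [seq w <- G | hit c w])%N.
    by rewrite size_filter -sum1_count [RHS]big_mkcond /=; apply: eq_bigr => w _; case: (hit c w).
  apply: uniq_leq_size => // w /HP[d Bw]; rewrite mem_filter [hit c w]d /=.
  apply/GP; split=> //; have [n1 n2] := sqball _ rS.
  have d1 := le_trans (abscissa_le _ _) d; have d2 := le_trans (ordinate_le _ _) d.
  have k3 : 2 ^- k <= 2 ^- (l + 3) :> R by rewrite lef_pV2 ?posrE // ler_weXn2l ?ler1n.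
  have e8 : 2 ^- (l + 3) = 2 ^- l / 8 :> R by rewrite exprD invfM; congr (_ * _^-1); ring.
  have l0 : 0 < 2 ^- l :> R by rewrite invr_gt0.
  apply: (le_trans (edist_le _ _)); rewrite e8 in k3 n1 n2.
  by move: d1 d2 n1 n2; rewrite !ler_norml => /andP[? ?] /andP[? ?] /andP[? ?] /andP[? ?];
     apply: (@le_trans _ _ (2 ^- l / 4 + 2 ^- l / 4)); [apply: lerD; rewrite ler_norml; lra|lra].
have nine w : \sum_(c <- u) (hit c w)%:R <= 9 :> R.
  rewrite -natr_sum -[leRHS]/(9%:R) ler_nat.
  rewrite (_ : (\sum_(c <- u) hit c w = \sum_(c <- u) ((c \in u) && hit c w))%N); last first.
    by rewrite big_seq [RHS]big_seq; apply: eq_bigr => c ->.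
  rewrite (_ : \sum_(c <- u) _ = size [seq c <- u | (c \in u) && hit c w])%N; last first.
    by rewrite size_filter -sum1_count [RHS]big_mkcond /=; apply: eq_bigr => c _; case: (_ && _).
  pose tri (a : int) := [:: a - 1; a; a + 1].
  rewrite -[9%N]/(size [seq (a, b) | a <- tri (dyfloor k.+1 (abscissa w / 2)), b <- tri
    (dyfloor k.+1 (ordinate w / 2))]).
  apply: uniq_leq_size; first exact: filter_uniq.
  move=> c; rewrite mem_filter => /andP[/andP[cu hc] _]; have [_ e] := repP _ cu.
  have tP (a b : R) : `|a - b| <= 2 ^- k -> dyfloor k.+1 (a / 2) \in tri (dyfloor k.+1 (b / 2)).
    move=> h; have := @dist_dyfloor R k.+1 1 (a / 2) (b / 2);
      rewrite mul1r half_dist // => /(_ h) /=.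
    by rewrite !inE; clear; lia.
  rewrite -e; apply/allpairsP; exists (cell X Y k.+1 (rep c)); split=> //=.
    by apply: tP; apply: le_trans hc; apply: abscissa_le.
  by apply: tP; apply: le_trans hc; apply: ordinate_le.
have tot : (size u)%:R * (C^-1 * 2 `^ ((N - k)%:R * s)) <= 9 * (C * 2 `^ ((N - l)%:R * s)).
  apply: (@le_trans _ _ (\sum_(c <- u) \sum_(w <- G) (hit c w)%:R)).
    have -> : (size u)%:R * (C^-1 * 2 `^ ((N - k)%:R * s)) = \sum_(c <- u) (C^-1 * 2 `^ ((N -
      k)%:R * s)).
      by rewrite big_const_seq iter_addr addr0 count_predT mulr_natl.
    by rewrite big_seq [leRHS]big_seq; apply: ler_sum.
  rewrite exchange_big /=; apply: (@le_trans _ _ (\sum_(w <- G) 9)).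
    by apply: ler_sum.
  by rewrite big_const_seq iter_addr addr0 count_predT -[_ *+ _]mulr_natr ler_pM2l.
rewrite /nimg -/u.
have q0 : 0 < C^-1 * 2 `^ ((N - k)%:R * s) by rewrite mulr_gt0 ?invr_gt0 ?powR_gt0.
rewrite -(ler_pM2r q0); apply: (le_trans tot); rewrite le_eqVlt; apply/orP; left; apply/eqP.
have -> : 2 `^ ((N - l)%:R * s) = 2 `^ (s * (k - l)%:R) * 2 `^ ((N - k)%:R * s) :> R.
  rewrite -powRD ?pnatr_eq0 ?implybT //; congr (_ `^ _).
  have lk' : (l <= k)%N by lia.
  by rewrite !natrB ?(leq_trans lk') ?(ltnW kN) //; ring.
by field; rewrite gt_eqF.
Qed.

(** A ball is first cut into at most 33^2 = 1089 squares four levels down, which leaves the margin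
    for [nimg_ball_le]; 9801 is 1089 * 9. The summand C 2^(2s) bounds the points of a square of
    level N, which fit in a ball of radius 2^-(N-2). *)
Lemma planar_cover_regular : (2 <= N)%N ->
  planar_cover X Y (9801 * C ^+ 2 + C * 2 `^ (2 * s)) s N.
Proof.
move=> N2; have p0 n : 0 < 2 ^+ n :> R by rewrite exprn_gt0.
have C0 : 0 < C by apply: lt_trans C1.
have C2 : 1 <= C ^+ 2 by rewrite exprn_ege1 // ltW.
have P0 : 0 <= C * 2 `^ (2 * s) by rewrite mulr_ge0 ?powR_ge0 // ltW.
have range (a : R) : 0 <= a <= 1 -> 0 <= a / 2 < 1 by move=> /andP[? ?]; apply/andP; split; lra.
split.
- by move=> z; apply: range; have [] := pt_unit z.
- by move=> z; apply: range; have [] := pt_unit z.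
- move=> l p y lp; set S := sqball X Y l y.
  have c1 : (nimg S (cell X Y (l + 4)) <= 1089)%N.
    have c33 (f : T -> R) : {in S, forall z, `|f z - f y| <= 2 ^- l} ->
      (nimg S (fun z => dyfloor (l + 4) (f z)) <= 33)%N.
      move=> H; apply: (@nimg_int _ _ _ (dyfloor (l + 4) (f y) - 16)) => z /H h.
      have := @dist_dyfloor R (l + 4) 16 (f z) (f y) _.
      have -> : 16%:R * 2 ^- (l + 4) = 2 ^- l :> R.
        by rewrite exprD invfM mulrCA (_ : 2 ^+ 4 = 16%:R) ?mulfV ?mulr1 ?pnatr_eq0 // -natrX.
      by move=> /(_ h) /=; lia.
    apply: leq_trans (nimg_pair _ _ _) _; rewrite -[1089%N]/(33 * 33)%N.
    by apply: leq_mul; apply: c33 => z; rewrite inE => /andP[].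
  pose m := Num.trunc (9 * C ^+ 2 * 2 `^ (s * p%:R)).
  have q0 : 1 <= 2 `^ (s * p%:R) :> R.
    by rewrite -[leLHS](powRr0 2) ler_powR ?ler1n // mulr_ge0 // ltW // (lt_trans _ s1).
  have r0 : 1 <= C ^+ 2 * 2 `^ (s * p%:R) by rewrite mulr_ege1.
  have cm : (nimg S (cell X Y (l + p)) <= nimg S (cell X Y (l + 4)) * m)%N.
    apply: nimg_le_mul => y' y'S; rewrite /m truncn_ge_nat;
      last by rewrite -mulrA mulr_ge0 // (le_trans ler01 r0).
    case: (ltnP p 4) => p4.
      apply: (@le_trans _ _ 1); last by rewrite -mulrA; lra.
      rewrite -[leRHS]/(1%:R) ler_nat.
      apply: leq_trans (_ : (size [:: cell X Y (l + p) y'] <= 1)%N) => //.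
      apply: nimg_le_size => z; rewrite !inE => /andP[_ /eqP e].
      apply/eqP; apply: (@cell_refine _ _ _ _ (l + p) (4 - p)).
      by rewrite -addnA subnKC // ltnW.
    have [k lpk] : exists k, (l + p = k.+1)%N by exists (l + p).-1; lia.
    rewrite lpk; apply: (le_trans (nimg_ball_le (y := y') (l := l) _ _ _)); [lia|lia| |].
      move=> z; rewrite !inE => /andP[_ /eqP zc].
      have : z \in sqball X Y (l + 4) y'.
        by apply: (fintype.subsetP (cell_sqball X Y (l + 4) y')); rewrite inE zc.
      by rewrite inE addnS !half_dist // => /andP[].
    rewrite ler_pM2l; last by rewrite mulr_gt0 // exprn_gt0.
    rewrite ler_powR ?ler1n //; apply: ler_wpM2l; last by rewrite ler_nat; lia.
    exact: ltW (lt_trans ltr01 s1).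
  have c1R : (nimg S (cell X Y (l + 4)))%:R <= 1089 :> R by rewrite ler_nat.
  have mR : m%:R <= 9 * C ^+ 2 * 2 `^ (s * p%:R).
    by rewrite truncn_le // -mulrA mulr_ge0 // (le_trans ler01 r0).
  have cmR : (nimg S (cell X Y (l + p)))%:R <= (nimg S (cell X Y (l + 4)))%:R * m%:R :> R.
    by rewrite -natrM ler_nat.
  apply: (le_trans cmR); apply: (le_trans (ler_pM _ _ c1R mR)); rewrite ?ler0n //.
  rewrite mulrDl; have : 0 <= C * 2 `^ (2 * s) * 2 `^ (s * p%:R) by rewrite mulr_ge0 ?powR_ge0.
  lra.
- move=> y; have kN : (N - 2 < N)%N by lia.
  have [u [uu uP _ cu]] := regular_ball (BT y) kN.
  apply: (@le_trans _ _ (C * 2 `^ (2 * s))); last by have := lt_le_trans ltr01 C2; lra.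
  rewrite subKn // in cu; apply: le_trans cu; rewrite ler_nat.
  rewrite cardE -(size_map pt); apply: uniq_leq_size; first by rewrite map_inj_uniq // enum_uniq.
  move=> w /mapP[z]; rewrite mem_enum => zc ->; apply/uP; split=> //.
  have : z \in sqball X Y N y by apply: (fintype.subsetP (cell_sqball X Y N y)).
  have [k Nk] : exists k, N = k.+1 by exists N.-1; rewrite (ltn_predK N2).
  rewrite inE Nk !half_dist // => /andP[h1 h2]; apply: (le_trans (edist_le _ _)).
  rewrite [ `|abscissa _ - _|]distrC [ `|ordinate _ - _|]distrC.
  have -> : 2 ^- (k.+1 - 2) = 2 ^- k + 2 ^- k :> R; last exact: lerD.
  have [j kj] : exists j, k = j.+1 by exists k.-1; lia.
  by rewrite kj !subSS subn0 exprS invfM; lra.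
Qed.

End Plane.

(** * From the planar set to a finite type of points *)

Lemma finite_regular_unit (R : realType) (s C : R) (N : nat) (B : set 'rV[R]_2) :
  (0 < N)%N -> discrete_ahlfors_regular s C N B -> finite_set (B `&` @unit_cube R 2).
Proof.
move=> N0 regB; pose code (x : 'rV[R]_2) := (dyfloor 1 (abscissa x), dyfloor 1 (ordinate x)).
pose D := [seq (a, b) | a <- [:: 0; 1; 2 : int], b <- [:: 0; 1; 2 : int]].
pose F c := B `&` @unit_cube R 2 `&` [set x | code x = c].
apply: (@sub_finite_set _ _ (\bigcup_(c in [set` D]) F c)).
  move=> x [Bx cx]; exists (code x) => //=.
  have rng (a : R) : 0 <= a <= 1 -> dyfloor 1 a \in [:: 0; 1; 2 : int].
    move=> /andP[a0 a1]; have : 0 <= dyfloor 1 a < 3.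
      by rewrite /dyfloor floor_ge0 floor_lt_int expr1; apply/andP; split; lra.
    by rewrite !inE; lia.
  apply/allpairsP; exists (code x); split => //; apply: rng; exact: cx.
apply: bigcup_finite; first exact: finite_seq.
move=> c _; have [[x [[Bx _] cx]]|none] := pselect (exists x, F c x); last first.
  by apply: (@sub_finite_set _ _ set0) => // x Fx; case: none; exists x.
have [_ h] := regB x Bx 0%N N0.
have [u [_ uP _]] := counting_ltyP (le_lt_trans h (ltry _)).
apply: (@sub_finite_set _ _ [set` u]); last exact: finite_seq.
move=> w [[Bw _] cw]; apply/uP; split=> //; rewrite /eball /= expr0 invr1.
have [e1 e2] : code x = code w by rewrite cx cw.
apply: (le_trans (edist_le _ _)); have := dyfloor_eq_dist e1; have := dyfloor_eq_dist e2.
by rewrite expr1; lra.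
Qed.

(** A grid interval determines its index, since it contains its left endpoint, so distinct values of
    [dyfloor] give distinct intervals meeting [F]. *)
Lemma nimg_le_grid_number (R : realType) (T : finType) (f : T -> R) (F : set R) (N : nat) (c :
  R) :
  (forall z, F (f z)) -> (grid_number F (2 ^- N) < c%:E)%E ->
  (nimg [set: T]%SET (fun z => dyfloor N (f z)))%:R <= c.
Proof.
move=> Ff; rewrite /grid_number => gc.
have [v [_ vP e]] := counting_ltyP (lt_trans gc (ltry _)).
move: gc; rewrite e lte_fin => /ltW; apply: le_trans; rewrite ler_nat.
have p0 : 0 < 2 ^+ N :> R by rewrite exprn_gt0.
pose Q (j : int) : set R := [set` `[j%:~R * 2 ^- N, (j + 1)%:~R * 2 ^- N[ ].
have inQ j w : Q j w <-> dyfloor N w = j.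
  rewrite /Q /= in_itv /=.
  rewrite ler_pdivrMr // ltr_pdivlMr // rmorphD /= [w * _]mulrC.
  by split=> [|<-]; [apply: dyfloor_itv|apply: dyfloor_bounds].
have Qinj : injective Q.
  move=> i j ij; have /inQ <- : Q j (i%:~R * 2 ^- N).
    rewrite -ij; apply/inQ/dyfloor_itv; rewrite mulrCA mulfV ?gt_eqF // mulr1; lra.
  by apply/esym/dyfloor_itv; rewrite mulrCA mulfV ?gt_eqF // mulr1; lra.
rewrite /nimg -(size_map Q); apply: uniq_leq_size.
  by rewrite map_inj_uniq // undup_uniq.
move=> q /mapP[j /mem_img[z _ <-] ->]; apply/vP; split; first by exists (dyfloor N (f z)).
by exists (f z); split; [apply/inQ|apply: Ff].
Qed.

Theorem theorem1p1 (R : realType) (s C t : R)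
    (hs : 1 < s) (hC : 1 < C) (ht0 : 0 < t) (ht1 : t < 1) :
  exists (eps : R) (N0 : nat), 0 < eps /\
    forall (N : nat) (A : set 'rV[R]_2), (N0 <= N)%N ->
      A `<=` @unit_cube R 2 ->
      (exists B : set 'rV[R]_2,
         discrete_ahlfors_regular s C N B /\ A `<=` B) ->
      (counting [set x | A x /\
          (grid_number (pinned_dist x A) (2 ^- N) < (2 `^ (t * N%:R))%:E)%E]
        <= (2 `^ ((s - eps) * N%:R))%:E)%E.
Proof.
pose K := 9801 * C ^+ 2 + C * 2 `^ (2 * s).
have K1 : 1 <= K.
  have C2 : 1 <= C ^+ 2 by rewrite exprn_ege1 // ltW.
  have : 0 <= C * 2 `^ (2 * s) by rewrite mulr_ge0 ?powR_ge0 //; lra.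
  rewrite /K; lra.
have [eps [N0 [eps0 H]]] := planar_case hs K1 ht0 ht1.
exists eps, (maxn N0 2); split=> // N A; rewrite geq_max => /andP[hN N2] Acube [B [regB AB]].
(* The argument is applied to the exceptional set itself: a point of [E] sees few distances to [A],
   hence few to [E]. *)
set E := [set x | _].
have fE : finite_set E.
  apply: sub_finite_set (finite_regular_unit (ltnW N2) regB) => x [Ax _].
  by split; [apply: AB|apply: Acube].
have [F EF] := (finite_fsetP.1 fE).
have cE : counting E = #|{: F}|%:R%:E :> \bar R.
  by rewrite /counting asboolT // EF set_fsetK cardfE.
rewrite cE lee_fin leNgt; apply/negP => big.
have EP (z : F) : E (val z) by rewrite EF /=; exact: valP.
pose pt (z : F) : 'rV[R]_2 := val z.
have BT z : B (pt z) by apply: AB; have [] := EP z.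
have cube z : 0 <= abscissa (pt z) <= 1 /\ 0 <= ordinate (pt z) <= 1.
  by have [/Acube h _] := EP z; split; apply: h.
have inj : injective pt by exact: val_inj.
apply: (H N F _ _ hN (planar_cover_regular hC hs regB BT cube inj N2)); last exact: ltW.
move=> x; have [_ g] := EP x.
apply: le_trans (nimg_le_grid_number (f := fun z => Defs.edist (pt x) (pt z)) _ g); last first.
  by move=> z; exists (pt z) => //; have [] := EP z.
rewrite ler_nat; apply: nimg_factor => z w _ _ e.
have [k Nk] : exists k, N = k.+1 by exists N.-1; rewrite (ltn_predK N2).
(* Halved coordinates halve distances, so level N there is level N - 1 for the original distances,
   coarser than the grid of mesh 2^-N. *)
have half y : dyfloor N (dst (fun z => abscissa (pt z) / 2) (fun z => ordinate (pt z) / 2) x y) =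
    dyfloor k (Defs.edist (pt x) (pt y)).
  rewrite /dyfloor Nk exprSr -mulrA; congr (Num.floor (_ * _)).
  rewrite edistE /dst -[X in X * _](ger0_norm (ler0n R 2)) -sqrtr_sqr -sqrtrM ?sqr_ge0 //.
  by congr Num.sqrt; field.
by rewrite !half; apply: (@dyfloor_refine _ k 1); rewrite addn1 -Nk.
Qed.
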